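(* Let $k\ge 2$ be an integer, let $G$ be an abelian group, and let $S$ be a finite non-empty subset of $G$ such that $S-S$ generates $G$, $S$ is not an arithmetic progression, $kS$ is aperiodic and $|kS|=k|S|-k+1$. Let $H$ be a hyper-atom of $S$, let $S_0$ be an $H$-component of $S$ of smallest cardinality, and let $\phi:G\to G/H$ be the canonical morphism. Then: (a) if $|2S|\neq |G|-1$, then $|H|\ge 2$; (b) $(S\setminus S_0)+H=S\setminus S_0$ and $|kS_0|=k|S_0|-k+1$; (c) either $\phi(S)$ is an arithmetic progression, or $k=2$ and one of the following holds: 1. $S=x-(G\setminus S)$ for some $x\in G$; 2. $(\phi(S)-\phi(S_0))\cap(\phi(S_0)-\phi(S))=\{\phi(0)\}$.
   Context: Notation: $A+B=\{a+b: a\in A,\ b\in B\}$, $A-B=\{a-b: a\in A,\ b\in B\}$, $x-A=\{x-a:a\in A\}$, and $kS=S+\cdots+S$ ($k$ summands). A set $A$ is aperiodic if $\{x\in G: x+A=A\}=\{0\}$. An arithmetic progression is a set of the form $\{a,a+d,\dots,a+(m-1)d\}$ with $m\ge 1$. For a subgroup $H$, an $H$-component of $S$ is a non-empty set of the form $S\cap(x+H)$. Let $S$ be a finite non-empty proper subset of $G$ such that $S-S$ generates $G$ (equivalently, $S$ generates $G$ when $0\in S$). Put $$\kappa_1(S)=\min\{|X+S|-|X| : X\subset G \text{ finite non-empty},\ X+S\neq G\}.$$ A ($1$-)fragment of $S$ is a finite non-empty set $X\subset G$ with $X+S\ne G$ and $|X+S|-|X|=\kappa_1(S)$. (It is known that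 some subgroup of $G$, possibly $\{0\}$, is a $1$-fragment of $S$.) A hyper-atom of $S$ is a maximal element (for inclusion) among the subgroups of $G$ that are $1$-fragments of $S$. *)

(* Defs.v *)
From HB Require Import structures.
From mathcomp Require Export all_boot all_order all_algebra generic_quotient ring_quotient.
From mathcomp Require Export finmap.
From mathcomp Require Export boolp classical_sets functions cardinality.

Set Implicit Arguments.
Unset Strict Implicit.
Unset Printing Implicit Defensive.

Import GRing.Theory Quotient.

Local Open Scope classical_set_scope.
Local Open Scope ring_scope.
Local Open Scope quotient_scope.

(* Subgroups of G are represented by K : zmodClosed G, with underlying set
   [set` K]. *)

Section Sumsets.
Variable G : zmodType.
Implicit Types (A B S X : set G) (H K : zmodClosed G).

(* Only meaningful on finite sets: fset_set of an infinite set is empty. *)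
Definition setcard A : nat := #|` fset_set A|%fset.

Definition sumset A B : set G := [set a + b | a in A & b in B].

Definition diffset A B : set G := [set a - b | a in A & b in B].

(* The empty sum is {0}. *)
Definition ksum (k : nat) S : set G := iter k (sumset S) [set 0].

Definition aperiodic A : Prop := [set x | sumset [set x] A = A] = [set 0].

Definition arith_prog A : Prop :=
  exists (a d : G) (m : nat), (0 < m)%N /\ A = [set a + d *+ i | i in `I_m].

Definition generated A : set G :=
  [set x | forall K, A `<=` [set` K] -> x \in K].

Definition generates A : Prop := generated A = [set: G].

Definition is_component H S A : Prop :=
  A !=set0 /\ exists x, A = S `&` sumset [set x] [set` H].

Definition is_smallest_component H S A : Prop :=
  is_component H S A /\
  forall B, is_component H S B -> (setcard A <= setcard B)%N.

Definition kappa1_admissible S X : Prop :=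
  [/\ finite_set X, X !=set0 & sumset X S <> [set: G]].

Definition deficiency S X : int := (setcard (sumset X S))%:Z - (setcard X)%:Z.

Definition kappa1_values S : set int :=
  [set deficiency S X | X in kappa1_admissible S].

(* The least element of kappa1_values S. It exists whenever S is a finite
   non-empty proper subset of G, so the default value 0 is irrelevant then. *)
Definition kappa1 S : int :=
  xget 0 (kappa1_values S `&` lbound (kappa1_values S)).

Definition is_fragment S X : Prop :=
  kappa1_admissible S X /\ deficiency S X = kappa1 S.

Definition is_hyper_atom S H : Prop :=
  is_fragment S [set` H] /\
  forall K, is_fragment S [set` K] -> [set` H] `<=` [set` K] ->
    [set` K] = [set` H].

Definition canonical_morphism H : G -> {quot H} := \pi_({quot H}).

End Sumsets.

(* Main.v *)
Require Import Defs.
From HB Require Import structures.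
From mathcomp Require Import all_boot all_order all_algebra ring_quotient.
From mathcomp Require Import finmap boolp classical_sets functions cardinality.
From mathcomp Require Import zify.

(* The proof is isoperimetric.  Minimal-size minimizers of |X + S| - |X| among
   the X with |X| >= j leaving at least j points uncovered ("j-atoms") meet in
   fewer than j points, by submodularity and by the symmetry X |-> -(G \ (X+S)).
   Hence a 1-atom through 0 is a subgroup, and a 2-atom through 0 is a subgroup
   or a Sidon set.  The latter yields a Vosper-type theorem: if |2S| = 2|S| - 1,
   2S misses two points and no nontrivial subgroup is a fragment, then S is a
   progression.  Modulo a nontrivial subgroup fragment H all the cosets of kS
   other than that of kS_0 are full, so aperiodicity forces k phi(S_0) to have a
   unique expression in k phi(S); counting then gives Kneser's bound for kS (by
   induction) and the equality cases.  For k >= 3 the Vosper-type theorem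
   applied to phi(S) shows that it is a progression. *)

Set Implicit Arguments.
Unset Strict Implicit.
Unset Printing Implicit Defensive.

Import Order.TTheory GRing.Theory.

Local Open Scope classical_set_scope.
Local Open Scope card_scope.
Local Open Scope ring_scope.

(** Everything is relative to an ambient subgroup [L], because generating sets change along the way:
    a 2-atom of [S] may generate a smaller group in which its own 2-atom has to be sought, and the
    induction for Kneser's bound passes from [S] to [S_0]. Since [L] may be infinite, complements
    are never counted directly, and the symmetry through complements is used only for finite [L];
    for infinite [L] the condition on uncovered points is automatic. Fullness of the cosets comes
    from a count of holes. A subgroup fragment [H] leaves at most [|H| - 1] points of [H + S]
    outside [S], so two distinct components have together more than [|H|] points, and the pigeonhole
    principle fills the coset of their sum; minimality of [S_0] extends this to every pair other
    than [S_0], [S_0]. Kneser's bound is then a sum of four inequalities, so equality for [kS] is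
    equality in each of them. For [k >= 3], unique expression shows that [2 phi(S)] misses at least
    [|phi(S)| - 1] points, which is the room that the Vosper-type theorem needs; for [k = 2] only
    the unique expression itself is left. *)

Lemma exists_min_nat (T : Type) (P : T -> Prop) (f : T -> nat) :
  (exists x, P x) -> exists2 x, P x & forall y, P y -> (f x <= f y)%N.
Proof.
move=> [x0 Px0].
have [n] := ubnP (f x0); elim: n x0 Px0 => // n IHn x0 Px0 le_n.
have [[y Py ylt]|nex] := pselect (exists2 y, P y & (f y < f x0)%N).
  by apply: (IHn y Py); lia.
exists x0 => // y Py; rewrite leqNgt; apply/negP => ylt; apply: nex.
by exists y.
Qed.

Lemma leq_card_disjoint (T : choiceType) (A B C : {fset T}) :
  (A `<=` C -> B `<=` C -> [disjoint A & B] -> #|` A| + #|` B| <= #|` C|)%fset%N.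
Proof.
move=> sAC sBC dAB.
have /eqP AB0 : (A `&` B == fset0)%fset by [].
have := cardfsUI A B; rewrite AB0 cardfs0 addn0 => <-.
by apply: fsubset_leq_card; rewrite fsubUset sAC.
Qed.

Lemma card_gt1_ex (T : choiceType) (A : {fset T}) (x : T) :
  (2 <= #|` A|)%N -> exists2 y, y \in A & y != x.
Proof.
rewrite (cardfsD1 x) => A2.
have : (0 < #|` A `\ x|%fset)%N by case: (x \in A) A2 => /=; lia.
by rewrite cardfs_gt0 => /fset0Pn[y]; rewrite !inE => /andP[]; exists y.
Qed.

(** * Sumsets, stabilizers and subgroups on finite sets *)

Section Sums.
Variable G : zmodType.
Local Open Scope fset_scope.
Local Open Scope ring_scope.
Implicit Types (A B C S X Y Z K : {fset G}) (L : zmodClosed G) (x y z : G).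

Definition fadd A B : {fset G} := [fset a + b | a in A, b in B].

Definition fopp A : {fset G} := [fset - a | a in A].

Definition shift x A : {fset G} := [fset x + a | a in A].

Definition fksum (k : nat) S : {fset G} := iter k (fadd S) [fset 0].

Lemma faddP A B x :
  reflect (exists a b, [/\ a \in A, b \in B & x = a + b]) (x \in fadd A B).
Proof.
apply: (iffP (imfset2P _ _ _ _ _)) => [[a aA [b bB ->]]|[a [b [aA bB ->]]]].
  by exists a, b.
by exists a => //; exists b.
Qed.

Lemma mem_fadd A B a b : a \in A -> b \in B -> a + b \in fadd A B.
Proof. by move=> aA bB; apply/faddP; exists a, b. Qed.

Lemma mem_shift x A y : (y \in shift x A) = (y - x \in A).
Proof.
apply/imfsetP/idP => [[a /= aA ->]|yA]; first by rewrite addrC addKr.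
by exists (y - x) => //; rewrite addrC subrK.
Qed.

Lemma card_shift x A : #|` shift x A| = #|` A|.
Proof. by rewrite card_imfset //; apply: addrI. Qed.

Lemma mem_fopp A y : (y \in fopp A) = (- y \in A).
Proof.
apply/imfsetP/idP => [[a /= aA ->]|yA]; first by rewrite opprK.
by exists (- y) => //; rewrite opprK.
Qed.

Lemma card_fopp A : #|` fopp A| = #|` A|.
Proof. by rewrite card_imfset //; apply: oppr_inj. Qed.

Lemma faddC A B : fadd A B = fadd B A.
Proof.
apply/fsetP => x; apply/faddP/faddP => -[a [b [aA bB ->]]];
by exists b, a; rewrite addrC.
Qed.

Lemma faddA A B C : fadd A (fadd B C) = fadd (fadd A B) C.
Proof.
apply/fsetP => x; apply/faddP/faddP => -[a [b [aA bB ->]]].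
  case/faddP: bB => c [d [cB dC ->]].
  by exists (a + c), d; rewrite addrA mem_fadd.
case/faddP: aA => c [d [cA dB ->]].
by exists c, (d + b); rewrite addrA mem_fadd.
Qed.

Lemma fadd1 x A : fadd [fset x] A = shift x A.
Proof.
apply/fsetP => y; rewrite mem_shift; apply/faddP/idP => [[a [b []]]|yA].
  by rewrite inE => /eqP-> bA ->; rewrite addrC addKr.
by exists x, (y - x); rewrite inE yA addrC subrK.
Qed.

Lemma fadd0l A : fadd [fset 0] A = A.
Proof. by rewrite fadd1; apply/fsetP=> x; rewrite mem_shift subr0. Qed.

Lemma faddS A B A' B' : A `<=` A' -> B `<=` B' -> fadd A B `<=` fadd A' B'.
Proof.
move=> /fsubsetP sA /fsubsetP sB; apply/fsubsetP => x /faddP[a [b [aA bB ->]]].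
by rewrite mem_fadd ?sA ?sB.
Qed.

Lemma faddUl A B C : fadd (A `|` B) C = fadd A C `|` fadd B C.
Proof.
apply/eqP; rewrite eqEfsubset fsubUset !faddS ?fsubsetUl ?fsubsetUr // !andbT.
apply/fsubsetP => x /faddP[a [c [+ cC ->]]].
by rewrite !inE => /orP[] aA; apply/orP; [left|right]; apply: mem_fadd.
Qed.

Lemma shift_fadd x A B : fadd (shift x A) B = shift x (fadd A B).
Proof. by rewrite -!fadd1 faddA. Qed.

Lemma shift_sub_faddl x A B : x \in A -> shift x B `<=` fadd A B.
Proof.
move=> xA; apply/fsubsetP => y; rewrite mem_shift => yB.
by rewrite -(subrK x y) addrC mem_fadd.
Qed.

Lemma fadd_sub0l A B : 0 \in A -> B `<=` fadd A B.
Proof. by move=> A0; apply/fsubsetP => b bB; rewrite -[b]add0r mem_fadd. Qed.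

Lemma leq_card_fadd A B : A != fset0 -> (#|` B| <= #|` fadd A B|)%N.
Proof.
case/fset0Pn => a aA; rewrite -(card_shift a); apply: fsubset_leq_card.
exact: shift_sub_faddl.
Qed.

Definition full_zmod : {pred G} := fun=> true.

Lemma full_zmod_closed : zmod_closed full_zmod. Proof. by []. Qed.

HB.instance Definition _ :=
  GRing.isZmodClosed.Build G full_zmod full_zmod_closed.

Definition gen_zmod (A : {fset G}) : {pred G} :=
  fun x => `[< forall L, {subset A <= L} -> x \in L >].

Lemma gen_zmod_closed A : zmod_closed (gen_zmod A).
Proof.
split; first by apply/asboolP => L _; rewrite rpred0.
move=> x y /asboolP xA /asboolP yA; apply/asboolP => L sAL.
by rewrite rpredB ?xA ?yA.
Qed.

HB.instance Definition _ A :=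
  GRing.isZmodClosed.Build G (gen_zmod A) (gen_zmod_closed A).

Lemma sub_gen A : {subset A <= gen_zmod A}.
Proof. by move=> x xA; apply/asboolP => L; apply. Qed.

Lemma gen_sub A L : {subset A <= L} -> {subset gen_zmod A <= L}.
Proof. by move=> sAL x /asboolP; apply. Qed.

Lemma gen_exists A : exists L, {subset A <= L} /\
  forall M : zmodClosed G, {subset A <= M} -> {subset L <= M}.
Proof.
by exists (gen_zmod A : zmodClosed G); split=> [|M];
  [exact: sub_gen|exact: gen_sub].
Qed.

Definition stab A : {pred G} := fun x => shift x A == A.

Lemma shiftD x y A : shift (x + y) A = shift x (shift y A).
Proof. by apply/fsetP => z; rewrite !mem_shift opprD addrA. Qed.

Lemma shift0 A : shift 0 A = A.
Proof. by apply/fsetP => z; rewrite !mem_shift subr0. Qed.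

Lemma stab_zmod_closed A : zmod_closed (stab A).
Proof.
split; first by rewrite unfold_in shift0.
move=> x y; rewrite !unfold_in => /eqP xA /eqP yA; apply/eqP.
by rewrite -{1}yA -shiftD subrK.
Qed.

HB.instance Definition _ A :=
  GRing.isZmodClosed.Build G (stab A) (stab_zmod_closed A).

Lemma stabP A x : (x \in stab A) = (shift x A == A).
Proof. by []. Qed.

Lemma stab_sub A x : shift x A `<=` A -> x \in stab A.
Proof. by move=> sA; rewrite stabP eqEfcard sA card_shift leqnn. Qed.

Lemma stab_mem A x a : x \in stab A -> a \in A -> x + a \in A.
Proof.
by rewrite stabP => /eqP E aA; rewrite -E mem_shift addrC addKr.
Qed.

Definition subgroup K := 0 \in K /\ {in K &, forall x y, x - y \in K}.

Lemma subgroupN K x : subgroup K -> x \in K -> - x \in K.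
Proof. by case=> K0 KB xK; rewrite -sub0r KB. Qed.

Lemma subgroupD K x y : subgroup K -> x \in K -> y \in K -> x + y \in K.
Proof.
by move=> sK xK yK; rewrite -[y]opprK; apply: sK.2 => //; apply: subgroupN.
Qed.

Lemma subgroup_zmod K : subgroup K -> exists L, L =i K.
Proof.
move=> sK; have cK : zmod_closed (fun x => x \in K).
  by case: sK.
pose L : zmodClosed G := HB.pack (fun x : G => x \in K)
  (GRing.isZmodClosed.Build G _ cK).
by exists L.
Qed.

Lemma zmod_subgroup L K : L =i K -> subgroup K.
Proof.
by move=> LK; split=> [|x y]; rewrite -!LK ?rpred0 //; apply: rpredB.
Qed.

Lemma zmod_finite L A a : (forall x, x \in L -> x + a \in A) -> exists K, L =i K.
Proof.
move=> sLA; exists [fset x in shift (- a) A | x \in L] => x.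
rewrite !inE /= mem_shift opprK; case: (boolP (x \in L)) => xL.
  by rewrite sLA.
by rewrite andbF.
Qed.

(** A witness [Y] replaces the cardinality of [L \ Z], so that the notion makes sense for infinite
    [L] as well. *)
Definition omits L j Z :=
  exists Y, [/\ {subset Y <= L}, (j <= #|` Y|)%N & [disjoint Y & Z]].

Lemma omitsS L j Z Z' : Z' `<=` Z -> omits L j Z -> omits L j Z'.
Proof.
move=> sZ [Y [sY jY dY]]; exists Y; split=> //.
by rewrite fdisjoint_sym; apply: (fdisjointWl sZ); rewrite fdisjoint_sym.
Qed.

Lemma exists_zmod_fset L : finite_set [set` L] ->
  exists K, L =i K.
Proof.
move=> fL; exists (fset_set [set` L]) => x; rewrite in_fset_set //.
by apply/idP/idP => [/mem_set|/set_mem].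
Qed.

(** Reduces each claim that a sumset leaves enough points of [L] uncovered to the case of finite
    [L], where one can count. *)
Lemma finite_or_omits L : (exists K, L =i K) \/ forall j Z, omits L j Z.
Proof.
have [fL|iL] := pselect (finite_set [set` L]);
  first by left; apply: exists_zmod_fset.
right; elim=> [|j IHj] Z.
  by exists fset0; split=> //; apply: fdisjoint0X.
have [Y [sY jY dY]] := IHj Z.
have [x /andP[xL]] : exists x, (x \in L) && (x \notin Y `|` Z).
  apply: contrapT => nex; apply: iL.
  apply: sub_finite_set (finite_fset (Y `|` Z)) => x xL /=.
  by apply: contrapT => /negP xN; apply: nex; exists x; rewrite xN andbT.
rewrite inE negb_or => /andP[xY xZ]; exists (x |` Y); split.
- by move=> y; rewrite !inE => /orP[/eqP->|/sY].
- by rewrite cardfsU1 xY.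
by apply/fdisjointP => y; rewrite !inE => /orP[/eqP->|/(fdisjointP dY)].
Qed.

End Sums.

(** * Atoms and their intersections *)

Section Atoms.
Variable G : zmodType.
Local Open Scope fset_scope.
Local Open Scope ring_scope.
Implicit Types (A B C S X Y Z K : {fset G}) (L : zmodClosed G) (x y z : G).

Definition admissible L j S X :=
  [/\ {subset X <= L}, (j <= #|` X|)%N & omits L j (fadd X S)].

(** The excess [|X + S| - |X|] is minimized first and the size of [X] second: the strict clause says
    that smaller admissible sets have larger excess. The additive form avoids truncated
    subtraction. *)
Definition atom L j S A := admissible L j S A /\
  forall X, admissible L j S X ->
    (#|` fadd A S| + #|` X| <= #|` fadd X S| + #|` A|)%N /\
    (#|` X| < #|` A| ->
     #|` fadd A S| + #|` X| < #|` fadd X S| + #|` A|)%N.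

Lemma sub_shift L x X : x \in L -> {subset X <= L} -> {subset shift x X <= L}.
Proof.
by move=> xL sX y; rewrite mem_shift => /sX yL; rewrite -(subrK x y) rpredD.
Qed.

Lemma omits_shift L j Z x : x \in L -> omits L j Z -> omits L j (shift x Z).
Proof.
move=> xL [Y [sY jY dY]]; exists (shift x Y); split.
- exact: sub_shift.
- by rewrite card_shift.
by apply/fdisjointP => y; rewrite !mem_shift => /(fdisjointP dY).
Qed.

Lemma admissible_shift L j S X x :
  x \in L -> admissible L j S X -> admissible L j S (shift x X).
Proof.
move=> xL [sX jX oX]; split; first exact: sub_shift.
  by rewrite card_shift.
by rewrite shift_fadd; apply: omits_shift.
Qed.

Lemma atom_shift L j S A x : x \in L -> atom L j S A -> atom L j S (shift x A).
Proof.
move=> xL [aA mA]; split; first exact: admissible_shift.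
by move=> X aX; rewrite shift_fadd !card_shift; apply: mA.
Qed.

Lemma atom_exists L j S X : (0 < j)%N -> S != fset0 -> admissible L j S X ->
  exists2 A, atom L j S A & 0 \in A.
Proof.
move=> j0 S0 aX.
have leX Y : (#|` Y| <= #|` fadd Y S|)%N by rewrite faddC leq_card_fadd.
pose d Y := (#|` fadd Y S| - #|` Y|)%N.
have [B aB mB] := @exists_min_nat _ (admissible L j S) d (ex_intro _ X aX).
pose P Y := admissible L j S Y /\ d Y = d B.
have [|A [aA dA] mA] := @exists_min_nat _ P (fun Y => #|` Y|).
  by exists B.
have atA : atom L j S A.
  split=> // Y aY; have := mB _ aY; rewrite -dA /d => dAY.
  have := leX A; have := leX Y; split; first by lia.
  move=> YA; rewrite ltnNge; apply/negP => le; have /mA : P Y; last by lia.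
  by split=> //; rewrite -dA /d; lia.
have /fset0Pn[a aA'] : A != fset0.
  by rewrite -cardfs_gt0; apply: leq_trans j0 _; case: aA.
exists (shift (- a) A); last by rewrite mem_shift sub0r opprK.
by apply: atom_shift => //; rewrite rpredN; case: aA => /(_ _ aA').
Qed.

(* When [L] is finite, [- (L \ (A + S))] is again admissible with the same
   excess as [A]; by minimality it is at least as large as the atom [A], which
   leaves enough room for [A `|` B] to be admissible too. *)
Lemma atom_inter L j S A B : (0 < j)%N -> {subset S <= L} ->
  atom L j S A -> atom L j S B -> (j <= #|` A `&` B|)%N -> A = B.
Proof.
move=> j0 sS atA atB jAB; apply/eqP/negPn/negP => nAB.
have [[sA jA oA] mA] := atA; have [[sB jB oB] mB] := atB.
have [e1 l1] := mA _ atB.1; have [e2 l2] := mB _ atA.1.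
have eqAB : #|` A| = #|` B| by case: (ltngtP #|` A| #|` B|) => //; lia.
have ltI : (#|` A `&` B| < #|` A|)%N.
  apply: fproper_ltn_card; rewrite fproperEneq fsubsetIl andbT.
  apply: contra nAB => /eqP E; rewrite eqEfcard eqAB leqnn andbT.
  by rewrite -E fsubsetIr.
have aI : admissible L j S (A `&` B).
  split=> //; first by move=> x; rewrite inE => /andP[/sA].
  by apply: omitsS oA; apply: faddS => //; apply: fsubsetIl.
have ltIS := (mA _ aI).2 ltI.
have subm : (#|` fadd (A `|` B) S| + #|` fadd (A `&` B) S|
    <= #|` fadd A S| + #|` fadd B S|)%N.
  rewrite faddUl -[leqRHS]cardfsUI leq_add2l fsubset_leq_card // fsubsetI.
  by rewrite !faddS ?fsubsetIl ?fsubsetIr.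
have cU := cardfsUI A B.
have sAS : {subset fadd A S <= L}.
  by move=> x /faddP[a [s [/sA aL /sS sL ->]]]; apply: rpredD.
have sU : {subset A `|` B <= L} by move=> x; rewrite inE => /orP[/sA|/sB].
have sUS : {subset fadd (A `|` B) S <= L}.
  by move=> x /faddP[a [s [/sU aL /sS sL ->]]]; apply: rpredD.
(* By [subm] and [cU] the excesses of union and intersection add up to at most twice that of [A].
   The intersection is smaller than the atom, so its excess is strictly larger; the union would then
   beat the minimum. *)
suff aU : admissible L j S (A `|` B) by have := (mA _ aU).1; lia.
split=> //; first by lia.
case: (finite_or_omits L) => [[F LF]|]; last exact.
have card_compl Z : {subset Z <= L} -> (#|` F `\` Z| + #|` Z| = #|` F|)%N.
  move=> sZ; rewrite -[RHS](cardfsID Z) addnC; congr (_ + _)%N.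
  by have /fsetIidPr-> : Z `<=` F by apply/fsubsetP => z /sZ; rewrite LF.
pose Y := F `\` fadd A S; have cY := card_compl _ sAS; rewrite -/Y in cY.
have disY : [disjoint fopp A & fadd (fopp Y) S].
  apply/fdisjointP => x; rewrite mem_fopp => xA; apply/negP => /faddP[y [s []]].
  rewrite mem_fopp !inE => /andP[yN _] sS' xE.
  by move: yN; rewrite -[- y](subrK s) -opprD -xE mem_fadd.
have sYL : {subset fopp Y <= L}.
  by move=> x; rewrite mem_fopp !inE -LF => /andP[_]; rewrite rpredN.
have aY : admissible L j S (fopp Y).
  split=> //.
    rewrite card_fopp; case: oA => Z [sZ jZ dZ]; apply: (leq_trans jZ).
    apply: fsubset_leq_card; apply/fsubsetP => z zZ.
    by rewrite !inE (fdisjointP dZ) // -LF sZ.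
  exists (fopp A); split; rewrite ?card_fopp //.
  by move=> x; rewrite mem_fopp => /sA; rewrite rpredN.
have cYS : (#|` A| + #|` fadd (fopp Y) S| <= #|` F|)%N.
  rewrite -(card_fopp A); apply: leq_card_disjoint disY; apply/fsubsetP => x.
    by rewrite mem_fopp -LF => /sA; rewrite rpredN.
  by case/faddP=> a [s [/sYL aL /sS sL ->]]; rewrite -LF; apply: rpredD.
have [leY ltY] := mA _ aY; rewrite card_fopp in leY ltY.
have leAY : (#|` A| <= #|` Y|)%N by rewrite leqNgt; apply/negP => /ltY; lia.
exists (F `\` fadd (A `|` B) S); split.
- by move=> x; rewrite !inE -LF => /andP[].
(* The uncovered part has size at least [|Y| - (|B + S| - |(A & B) + S|)], which exceeds
   [|Y| - |A| + |A & B|] by [ltIS], hence exceeds [j]. *)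
- by have := card_compl _ sUS; lia.
by apply/fdisjointP => x; rewrite inE => /andP[].
Qed.

(** Translates of an atom by elements of [L] are atoms, so a large overlap with [A] forces equality
    with [A]. *)
Lemma atom_stab L j S A x : (0 < j)%N -> {subset S <= L} ->
  atom L j S A -> (j <= #|` A `&` shift x A|)%N -> x \in stab A.
Proof.
move=> j0 sS atA jx.
have /fset0Pn[y] : A `&` shift x A != fset0.
  by rewrite -cardfs_gt0; apply: leq_trans jx.
rewrite !inE mem_shift => /andP[yA yxA]; have [[sA _ _] _] := atA.
have xL : x \in L by rewrite -[x](subKr y) rpredB ?sA.
apply/eqP/esym; apply: (atom_inter j0 sS atA) => //.
exact: atom_shift.
Qed.

Lemma atom1_subgroup L S A : {subset S <= L} -> atom L 1 S A -> 0 \in A ->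
  subgroup A.
Proof.
move=> sS atA A0.
have st a : a \in A -> - a \in stab A.
  move=> aA; apply: (atom_stab _ sS atA) => //; rewrite cardfs_gt0.
  by apply/fset0Pn; exists 0; rewrite inE A0 mem_shift sub0r opprK.
by split=> // x y xA /st yS; rewrite addrC; apply: stab_mem.
Qed.

(** One non-zero period [x] suffices: for [a] in [A] the sets [A] and [a + A] share the two points
    [a] and [x + a], so every [a] is a period as well. *)
Lemma atom2_subgroup_or_sidon L S A :
    {subset S <= L} -> atom L 2 S A -> 0 \in A ->
  subgroup A \/ forall x, x != 0 -> (#|` A `&` shift x A| <= 1)%N.
Proof.
move=> sS atA A0.
have [[x x0 stx]|nex] := pselect (exists2 x, x != 0 & x \in stab A); last first.
  right=> x x0; rewrite leqNgt; apply/negP => c2; apply: nex; exists x => //.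
  exact: (atom_stab _ sS atA).
left; have st a : a \in A -> a \in stab A.
  move=> aA; apply: (atom_stab _ sS atA) => //.
  have : [fset a; x + a] `<=` A `&` shift a A.
    apply/fsubsetP => y; rewrite !inE mem_shift => /orP[]/eqP->.
      by rewrite aA subrr.
    by rewrite addrK stab_mem //= -[x]addr0 stab_mem.
  move/fsubset_leq_card; apply: leq_trans; rewrite cardfs2.
  by rewrite -subr_eq0 opprD addrCA subrr addr0 oppr_eq0 x0.
split=> // a b aA bA; rewrite addrC; apply: stab_mem => //.
by rewrite rpredN st.
Qed.

End Atoms.

(** * A Vosper-type theorem *)

Section Vosper.
Variable G : zmodType.
Local Open Scope fset_scope.
Local Open Scope ring_scope.
Implicit Types (A B C D R S X Y Z K : {fset G}) (L : zmodClosed G) (x y z : G).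

Definition sidon A := forall x, x != 0 -> (#|` A `&` shift x A| <= 1)%N.

Definition progression S := exists a d (m : nat), (0 < m)%N /\
  forall x, x \in S <-> exists2 i, (i < m)%N & x = a + d *+ i.

Lemma sidon_shift A x y : sidon A -> x != y ->
  (#|` shift x A `&` shift y A| <= 1)%N.
Proof.
move=> sdA nxy.
have -> : shift x A `&` shift y A = shift x (A `&` shift (y - x) A).
  by apply/fsetP => z; rewrite !inE !mem_shift !inE mem_shift opprB addrA subrK.
by rewrite card_shift; apply: sdA; rewrite subr_eq0 eq_sym.
Qed.

(** Inclusion-exclusion for three translates of [A], which meet pairwise in at most one point. *)
Lemma sidon_card_fadd A B :
  sidon A -> (3 <= #|` B|)%N -> (3 * #|` A| <= #|` fadd B A| + 3)%N.
Proof.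
move=> sdA B3.
have /fset0Pn[b bB] : B != fset0 by rewrite -cardfs_gt0; lia.
have : (2 <= #|` B `\ b|)%N by move: B3; rewrite (cardfsD1 b) bB.
move=> /[dup] /(card_gt1_ex b)[c cB cb] B2.
have /fset0Pn[e eB] : B `\ b `\ c != fset0.
  by rewrite -cardfs_gt0; move: B2; rewrite (cardfsD1 c) cB; lia.
move: cB eB; rewrite !inE => /andP[_ cB] /and3P[ec eb eB].
have i1 := sidon_shift sdA cb; have i2 := sidon_shift sdA ec.
have i3 := sidon_shift sdA eb.
have /fsubset_leq_card : shift e A `|` (shift c A `|` shift b A) `<=` fadd B A.
  by rewrite !fsubUset !shift_sub_faddl.
have := cardfsUI (shift c A) (shift b A).
have := cardfsUI (shift e A) (shift c A `|` shift b A).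
have := cardfsUI (shift e A `&` shift c A) (shift e A `&` shift b A).
rewrite -fsetIUr !card_shift; lia.
Qed.

Lemma card_inter_shift A B d : 0 \in B -> d \in B ->
  (#|` A| + #|` A| <= #|` fadd B A| + #|` A `&` shift d A|)%N.
Proof.
move=> B0 dB; rewrite -[X in (_ + X <= _)%N](card_shift d) -cardfsUI leq_add2r.
by apply: fsubset_leq_card; rewrite fsubUset fadd_sub0l ?shift_sub_faddl.
Qed.

(* A set with [|S + {0, d}| = |S| + 1] has exactly one point without
   predecessor: follow the progression starting there. *)
Lemma card_fadd_pair S d : #|` fadd [fset 0; d] S| = (#|` S|).+1 ->
  progression S \/
  exists f R, [/\ R `<=` S, R != fset0, R != S, d \in stab R &
    forall x, x \in S -> x \notin R -> x - f \in gen_zmod [fset d]].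
Proof.
have -> : fadd [fset 0; d] S = S `|` shift d S.
  by rewrite faddUl !fadd1 shift0.
move=> cU; have := cardfsUI S (shift d S); rewrite card_shift cU => cI.
have c1 := cardfsID (shift d S) S.
have c2 := cardfsID S (shift d S); rewrite fsetIC card_shift in c2.
have /cardfs1P[f fE] : #|` S `\` shift d S| == 1%N by apply/eqP; lia.
have /cardfs1P[e eE] : #|` shift d S `\` S| == 1%N by apply/eqP; lia.
have : f \in S `\` shift d S by rewrite fE inE.
rewrite inE mem_shift => /andP[fd fS].
have eP x : x \in S -> x + d \notin S -> x + d = e.
  move=> xS xd; have : x + d \in shift d S `\` S.
    by rewrite inE mem_shift addrK xS xd.
  by rewrite eE inE => /eqP.
(* If the progression from [f] never left [S], its points would form a finite [d]-stable set, and
   [f] would have a predecessor in [S]. *)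
have [i0 i0P] : exists i, f + d *+ i \notin S.
  apply: contrapT => nex.
  pose P := [fset x in S | `[< exists i, x = f + d *+ i >]].
  have stP : d \in stab P.
    apply: stab_sub; apply/fsubsetP => x; rewrite mem_shift !inE /=.
    move=> /andP[_ /asboolP[i xE]].
    have -> : x = f + d *+ i.+1 by rewrite mulrSr addrA -xE subrK.
    apply/andP; split; last by apply/asboolP; exists i.+1.
    by apply: contrapT => /negP ?; apply: nex; exists i.+1.
  have : f \in P by rewrite !inE fS; apply/asboolP; exists 0%N; rewrite addr0.
  by rewrite -(eqP stP) mem_shift !inE (negPf fd).
have [m mP m_min] := ex_minnP (ex_intro (fun i => f + d *+ i \notin S) i0 i0P).
have mS i : (i < m)%N -> f + d *+ i \in S.
  by move=> im; apply: contraLR im => /m_min; rewrite -leqNgt.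
have m0 : (0 < m)%N.
  by rewrite lt0n; apply: contraNneq mP => ->; rewrite addr0.
have eE' : e = f + d *+ m.
  rewrite -(prednK m0) mulrSr addrA; apply/esym/eP; first by apply: mS; lia.
  by rewrite -addrA -mulrSr prednK.
pose R := [fset x in S | ~~ `[< exists2 i, (i < m)%N & x = f + d *+ i >]].
have RP x : x \in S -> x \notin R -> exists2 i, (i < m)%N & x = f + d *+ i.
  by move=> xS; rewrite !inE xS /= negbK => /asboolP.
have sR : R `<=` S by apply/fsubsetP => x; rewrite !inE => /andP[].
have [R0|R0] := eqVneq R fset0.
  left; exists f, d, m; split=> // x; split=> [xS|[i im ->]]; last exact: mS.
  by apply: RP; rewrite // R0 inE.
right; exists f, R; split=> //.
- apply/eqP => RS; have : f \in R by rewrite RS.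
  rewrite !inE fS /= => /asboolP[]; exists 0%N => //.
  by rewrite addr0.
- apply: stab_sub; apply/fsubsetP => x; rewrite mem_shift !inE /=.
  move=> /andP[xS /asboolP xN]; apply/andP; split.
    apply: contrapT => /negP xdN; apply: xN; exists m.-1; first by lia.
    apply/eqP; rewrite subr_eq -addrA -mulrSr prednK // -eE'; apply/eqP.
    by rewrite -[LHS](subrK d); apply: eP; rewrite ?subrK.
  apply/asboolP => -[[|i] im xE].
    by move: xS; rewrite xE addr0 (negPf fd).
  by apply: xN; exists i; rewrite ?(ltnW im) // xE mulrSr addrA addrK.
move=> x xS /(RP _ xS)[i _ ->]; rewrite addrC addKr rpredMn //.
by apply: sub_gen; rewrite inE.
Qed.

(** [L] is finite because it acts on the finite set [D]. As [L + S] lies in [(f + L)] together with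
    [D], it is too small to be a proper subset of the group, so [L + S] is everything; moving the
    [L]-part onto [D] then makes [S + S] everything. *)
Lemma no_periodic_part S L D f :
    (forall K, subgroup K -> (2 <= #|` K|)%N -> (exists y, y \notin fadd K S) ->
      (#|` K| + #|` S| <= #|` fadd K S|)%N) ->
    (exists y, y \notin fadd S S) ->
    (exists2 x, x \in L & x != 0) ->
    D `<=` S -> D != fset0 -> D != S -> {subset L <= stab D} ->
    (forall x, x \in S -> x \notin D -> x - f \in L) -> False.
Proof.
move=> HK [y0 y0N] [x0 x0L x0N0] sD /fset0Pn[d dD] nDS LD Sf.
have [K LK] : exists K, L =i K.
  by apply: (@zmod_finite _ L D d) => x /LD xD; apply: stab_mem.
have sK := zmod_subgroup LK.
have K2 : (2 <= #|` K|)%N.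
  have : [fset 0; x0] `<=` K.
    by apply/fsubsetP => x; rewrite !inE -LK => /orP[]/eqP->; rewrite ?rpred0.
  by move/fsubset_leq_card; rewrite cardfs2 eq_sym x0N0.
have KN y : y \in fadd K S.
  apply: contrapT => /negP yN; have := HK K sK K2 (ex_intro _ y yN).
  have /fsubset_leq_card : fadd K S `<=` shift f K `|` D.
    apply/fsubsetP => _ /faddP[h [s [hK sS ->]]].
    rewrite inE mem_shift; have [sinD|sinD] := boolP (s \in D).
      by apply/orP; right; apply: stab_mem => //; apply: LD; rewrite LK.
    by rewrite -addrA -LK rpredD ?Sf ?LK.
  have := cardfsUI (shift f K) D; rewrite card_shift.
  have : (#|` D| < #|` S|)%N by apply: fproper_ltn_card; rewrite fproperEneq nDS.
  lia.
move: y0N; case/faddP: (KN (y0 - d)) => h [s [hK sS E]].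
rewrite -(subrK d y0) E addrAC mem_fadd //; apply: (fsubsetP sD).
by apply: stab_mem; rewrite ?LD ?LK.
Qed.

(* Vosper-type theorem: a [2]-atom [A] of [S] which is neither a pair nor a
   subgroup is a Sidon set, and so is a [2]-atom [B] of [A] (inside the group
   generated by [A]); but Sidon sets have large sumsets. *)
Lemma vosper_progression S :
    (forall X, X != fset0 -> (exists y, y \notin fadd X S) ->
      (#|` X| + #|` S| <= #|` fadd X S| + 1)%N) ->
    (forall K, subgroup K -> (2 <= #|` K|)%N -> (exists y, y \notin fadd K S) ->
      (#|` K| + #|` S| <= #|` fadd K S|)%N) ->
    (2 <= #|` S|)%N -> (#|` fadd S S| + 1 <= 2 * #|` S|)%N ->
    omits (@full_zmod G : zmodClosed G) 2 (fadd S S) ->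
  progression S.
Proof.
move=> HX HK S2 SS oSS.
have omits_ex L j Z : (0 < j)%N -> omits L j Z -> exists2 y, y \in L & y \notin Z.
  move=> j0 [Y [sY jY dY]].
  have /fset0Pn[y yY] : Y != fset0 by rewrite -cardfs_gt0; lia.
  by exists y; rewrite ?sY ?(fdisjointP dY).
have S0 : S != fset0 by rewrite -cardfs_gt0; lia.
have sST : {subset S <= (@full_zmod G : zmodClosed G)} by [].
have [y0 _ y0N] := omits_ex _ 2 _ isT oSS.
have noper L D f := @no_periodic_part S L D f HK (ex_intro _ y0 y0N).
have aS : admissible (@full_zmod G : zmodClosed G) 2 S S by split.
have [A atA A0] := atom_exists (ltn0Sn 1) S0 aS.
have [[_ A2 oA] mA] := atA.
have cAS : (#|` fadd A S| + 1 <= #|` A| + #|` S|)%N by have := (mA _ aS).1; lia.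
have [y1 _ y1N] := omits_ex _ 2 _ isT oA.
have nA0 : A != fset0 by rewrite -cardfs_gt0; lia.
have cAS' := HX A nA0 (ex_intro _ y1 y1N).
case: (atom2_subgroup_or_sidon sST atA A0) => [sgA|sdA].
  by have := HK A sgA A2 (ex_intro _ y1 y1N); lia.
have [d dA d0] := card_gt1_ex 0 A2.
have [A3|A3] := ltnP #|` A| 3.
  have EA : A = [fset 0; d].
    apply/esym/eqP; rewrite eqEfcard cardfs2 [0 == d]eq_sym d0 -ltnS A3 andbT.
    by apply/fsubsetP => x; rewrite !inE => /orP[]/eqP->.
  have cA : #|` A| = 2%N by lia.
  have cP : #|` fadd [fset 0; d] S| = (#|` S|).+1 by rewrite -EA; lia.
  case: (card_fadd_pair cP) => [//|[f [R [sR R0 nRS stR Rf]]]].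
  exfalso; apply: (noper (gen_zmod [fset d]) R f) => //.
    by exists d => //; apply: sub_gen; rewrite inE.
  by apply: gen_sub => x; rewrite inE => /eqP->.
exfalso; have [L [AL genL]] := gen_exists A.
have Lnt : exists2 x, x \in L & x != 0 by exists d; rewrite ?AL.
(* The part of [S] in the coset [x + L]: translated into [L], it is a candidate against which [A]
   can play the role of [S]. *)
pose comp x := [fset s in S | s - x \in L].
have compS x : comp x `<=` S by apply/fsubsetP => s; rewrite !inE => /andP[].
have compL x : {subset shift (- x) (fadd (comp x) A) <= L}.
  move=> z; rewrite mem_shift opprK => /faddP[s [a [+ aA E]]].
  rewrite !inE /= => /andP[_ sL]; rewrite -(addrK x z) E addrAC.
  by apply: rpredD => //; apply: AL.
have card_comp x : (#|` fadd A (comp x)| + #|` fadd A (S `\` comp x)|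
    <= #|` fadd A S|)%N.
  apply: leq_card_disjoint.
  - exact: faddS.
  - by apply: faddS => //; apply: fsubsetDl.
  apply/fdisjointP => z /faddP[a [s [aA + zE]]]; rewrite !inE /= => /andP[_ sL].
  apply/negP => /faddP[b [t [bA]]]; rewrite !inE negb_and /=.
  move=> /andP[/orP[/negP tS //|/negP tL] tS] zE'; apply: tL.
  have -> : t = a + s - b by rewrite -zE zE' addrC addKr.
  rewrite addrAC -[a + s - x]addrA.
  by apply: rpredB; [apply: rpredD; [apply: AL|exact: sL]|apply: AL].
(* Otherwise no excess remains for the other cosets: [D = A + D], so [D] is stable under [L], which
   [no_periodic_part] excludes. *)
have tight x : comp x != fset0 -> comp x != S ->
    (#|` fadd A (comp x)| + 2 <= #|` A| + #|` comp x|)%N.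
  move=> C0 CS; rewrite leqNgt; apply/negP => tgt.
  pose D := S `\` comp x; have sD : D `<=` fadd A D by apply: fadd_sub0l.
  have cD : (#|` comp x| + #|` D| = #|` S|)%N.
    rewrite -[RHS](cardfsID (comp x)); congr (_ + _)%N.
    by have /fsetIidPr-> := compS x.
  have ED : D = fadd A D.
    apply/eqP; rewrite eqEfcard sD; have := card_comp x; rewrite -/D.
    by move: cAS tgt cD; clear; lia.
  apply: (noper L D x) => //.
  - exact: fsubsetDl.
  - have : (#|` comp x| < #|` S|)%N.
      by apply: fproper_ltn_card; rewrite fproperEneq CS compS.
    by rewrite -cardfs_gt0; move: cD; clear; lia.
  - apply: contraNneq C0 => DS; rewrite -cardfs_eq0; move: cD; rewrite DS.
    by clear; lia.
  - apply: genL => a aA; apply: stab_sub; rewrite [X in _ `<=` X]ED.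
    exact: shift_sub_faddl.
  by move=> s sS; rewrite !inE sS andbT negbK => /andP[].
have comp_le x : comp x != fset0 -> (#|` A| <= #|` fadd A (comp x)|)%N.
  by move=> C0; rewrite faddC leq_card_fadd.
have fsg F : L =i F -> (subgroup F /\ (2 <= #|` F|)%N).
  move=> LF; split; first exact: zmod_subgroup LF.
  apply: leq_trans A2 _; apply: fsubset_leq_card.
  by apply/fsubsetP => a /AL; rewrite LF.
(* The aim is a part admissible for [A] inside [L], so that a 2-atom [B] of [A] exists. The cases
   are: [S] in one coset, several cosets with [L] finite, several cosets with [L] infinite. *)
have [x [C2 cAC oC]] : exists x, [/\ (2 <= #|` comp x|)%N,
    (#|` fadd A (comp x)| + 1 <= #|` A| + #|` comp x|)%N &
    omits L 2 (shift (- x) (fadd (comp x) A))].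
  have [[x Cx]|nC] := pselect (exists x, comp x = S).
    exists x; rewrite Cx; split=> //.
    case: (finite_or_omits L) => [[F LF]|]; last exact.
    have [sF F2] := fsg _ LF.
    have FSx : fadd F S `<=` shift x F.
      apply/fsubsetP => z /faddP[h [s [hF + ->]]].
      rewrite -Cx !inE mem_shift /= => /andP[_ sL].
      by rewrite -addrA -LF rpredD // LF.
    have FS z : z \in fadd F S.
      apply: contrapT => /negP zN; have := HK _ sF F2 (ex_intro _ z zN).
      by have := fsubset_leq_card FSx; rewrite card_shift; move: S2; clear; lia.
    case: oA => Y [_ Y2 dY]; exists (shift (- x) Y); split.
    - move=> z; rewrite mem_shift opprK => _.
      by have /(fsubsetP FSx) := FS (z + x); rewrite mem_shift addrK LF.
    - by rewrite card_shift.
    by apply/fdisjointP => z; rewrite !mem_shift faddC => /(fdisjointP dY).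
  case: (finite_or_omits L) => [[F LF]|oL].
    have [sF F2] := fsg _ LF.
    have AF : A `<=` F by apply/fsubsetP => a /AL; rewrite LF.
    have [y yF yA] : exists2 y, y \in fadd F S & y \notin fadd A S.
      apply: contrapT => nex.
      have sFA : fadd F S `<=` fadd A S.
        apply/fsubsetP => z zF; apply: contrapT => /negP zA.
        by apply: nex; exists z.
      have := HK _ sF F2 (ex_intro _ y1 (contra (fsubsetP sFA y1) y1N)).
      have := fsubset_leq_card sFA; have := fsubset_leq_card AF.
      by move: cAS; clear; lia.
    exists y.
    have C0 : comp y != fset0.
      case/faddP: yF => h [s [hF sS yE]]; apply/fset0Pn; exists s.
      by rewrite !inE sS /= yE opprD addrCA subrr addr0 rpredN LF.
    have nCS : comp y != S by apply/eqP => E; apply: nC; exists y.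
    have tC := tight y C0 nCS; have lC := comp_le y C0.
    split; [by move: tC lC; clear; lia|by move: tC; clear; lia|].
    (* Since [y] is outside [A + S], the sets [-A] and [comp y - y] are disjoint in [F]; with the
       margin 2 of [tight], two points of [F] stay uncovered. *)
    have le1 : (#|` fopp A| + #|` shift (- y) (comp y)| <= #|` F|)%N.
      apply: leq_card_disjoint.
      - by apply/fsubsetP => z; rewrite mem_fopp -LF => /AL; rewrite rpredN.
      - by apply/fsubsetP => z; rewrite mem_shift opprK !inE addrK LF => /andP[].
      apply/fdisjointP => z; rewrite mem_fopp mem_shift opprK => zA.
      apply: contra yA => zC; rewrite -[y](addKr z).
      by apply: mem_fadd => //; apply: (fsubsetP (compS y)).
    exists (F `\` shift (- y) (fadd (comp y) A)); split.
    - by move=> z; rewrite inE -LF => /andP[].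
    - move: le1; rewrite cardfsDS ?card_fopp ?card_shift.
        by rewrite [fadd (comp y) A]faddC; move: tC; clear; lia.
      by apply/fsubsetP => z /compL; rewrite LF.
    by apply/fdisjointP => z; rewrite inE => /andP[].
  case/fset0Pn: (S0) => x xS; exists x.
  have C0 : comp x != fset0
    by apply/fset0Pn; exists x; rewrite !inE xS subrr rpred0.
  have nCS : comp x != S by apply/eqP => E; apply: nC; exists x.
  have tC := tight x C0 nCS; have lC := comp_le x C0.
  by split; [move: tC lC|move: tC|exact: oL]; clear; lia.
have aC : admissible L 2 A (shift (- x) (comp x)).
  split; last by rewrite shift_fadd.
    by move=> z; rewrite mem_shift opprK !inE addrK => /andP[].
  by rewrite card_shift.
have [B atB B0] := atom_exists (ltn0Sn 1) nA0 aC.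
have [[_ B2 oB] mB] := atB.
have cAB : (#|` fadd B A| + 1 <= #|` A| + #|` B|)%N.
  have [+ _] := mB _ aC; rewrite shift_fadd !card_shift [fadd (comp x) A]faddC.
  by move: cAC; clear; lia.
have [e eB e0] := card_gt1_ex 0 B2.
have ce := card_inter_shift A B0 eB; have se := sdA _ e0.
(* A subgroup [B] cannot contain [A], or [B + A] would cover [L]. Hence [2|B| <= |A + B|], so
   [|B| < |A|], while the Sidon property of [A] gives [2|A| <= |A + B| + 1 <= |A| + |B|]. *)
case: (atom2_subgroup_or_sidon AL atB B0) => [sgB|sdB].
  have [a aA aB] : exists2 a, a \in A & a \notin B.
    apply: contrapT => nex; have [M MB] := subgroup_zmod sgB.
    have LM : {subset L <= M}.
      apply: genL => a aA; rewrite MB; apply: contrapT => /negP aB.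
      by apply: nex; exists a.
    have [y yL] := omits_ex _ 2 _ isT oB.
    by rewrite -[y]addr0 mem_fadd // -MB LM.
  have : (#|` B| + #|` shift a B| <= #|` fadd B A|)%N.
    apply: leq_card_disjoint.
    - by rewrite faddC fadd_sub0l.
    - by rewrite faddC shift_sub_faddl.
    apply/fdisjointP => z zB; rewrite mem_shift; apply: contra aB => zaB.
    by rewrite -(subKr z a) sgB.2.
  by rewrite card_shift; move: cAB ce se; clear; lia.
have [B3|B3] := ltnP #|` B| 3; first by move: A3 cAB ce se B3; clear; lia.
(* The two bounds add up to [3(|A| + |B|) <= 2|A + B| + 6 <= 2(|A| + |B|) + 4], impossible when both
   sizes are at least 3. *)
have := sidon_card_fadd sdA B3; have := sidon_card_fadd sdB A3.
by rewrite [fadd A B]faddC; move: A3 B3 cAB; clear; lia.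
Qed.

End Vosper.

(** * Iterated sums modulo a subgroup fragment, and Kneser's bound *)

Section Ksums.
Variable G : zmodType.
Local Open Scope fset_scope.
Local Open Scope ring_scope.
Implicit Types (A B C D R S X Y Z K : {fset G}) (L : zmodClosed G) (x y z : G).

Lemma fksumS k S : fksum k.+1 S = fadd S (fksum k S).
Proof. by []. Qed.

Lemma fksum1 S : fksum 1 S = S.
Proof. by rewrite fksumS faddC fadd0l. Qed.

Lemma fksum_mono k S S' : S `<=` S' -> fksum k S `<=` fksum k S'.
Proof. by move=> sS; elim: k => // k IHk; rewrite !fksumS faddS. Qed.

Lemma fksum_shift k S x : fksum k (shift x S) = shift (x *+ k) (fksum k S).
Proof.
elim: k => [|k IHk]; first by rewrite mulr0n shift0.
rewrite !fksumS IHk shift_fadd [fadd S (shift _ _)]faddC shift_fadd.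
by rewrite [fadd _ S]faddC -shiftD mulrS.
Qed.

Lemma stab_shift x A : stab (shift x A) =i stab A.
Proof.
move=> y; rewrite !stabP -shiftD addrC shiftD.
apply/eqP/eqP => [E|-> //]; rewrite -[LHS]shift0 -[RHS]shift0 -(addNr x).
by rewrite !(shiftD (- x)) E.
Qed.

Lemma mem_fksum k S x : x \in S -> x *+ k \in fksum k S.
Proof.
move=> xS; elim: k => [|k IHk]; first by rewrite inE.
by rewrite mulrS mem_fadd.
Qed.

Lemma fksum_neq0 k S : S != fset0 -> fksum k S != fset0.
Proof.
by case/fset0Pn => x xS; apply/fset0Pn; exists (x *+ k); apply: mem_fksum.
Qed.

Lemma fksum_zmod L k S : {subset S <= L} -> {subset fksum k S <= L}.
Proof.
move=> SL; elim: k => [|k IHk] z; first by rewrite inE => /eqP->; rewrite rpred0.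
by case/faddP => s [u [/SL sL /IHk uL ->]]; apply: rpredD.
Qed.

Definition coset_part K S x := [fset s in S | s - x \in K].

Section Decomposition.
Variables (L : zmodClosed G) (S K : {fset G}) (s0 : G).
Hypothesis SL : {subset S <= L}.
Hypothesis KL : {subset K <= L}.
Hypothesis sgK : subgroup K.
Hypothesis K2 : (2 <= #|` K|)%N.
Hypothesis cK : (#|` fadd K S| + 1 <= #|` S| + #|` K|)%N.
Hypothesis kappaK : forall X, {subset X <= L} -> X != fset0 ->
  (exists2 y, y \in L & y \notin fadd X S) ->
  (#|` X| + #|` fadd K S| <= #|` fadd X S| + #|` K|)%N.
Hypothesis s0S : s0 \in S.
Hypothesis min_s0 : forall s, s \in S ->
  (#|` coset_part K S s0| <= #|` coset_part K S s|)%N.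
Hypothesis nS : exists2 s, s \in S & s \notin coset_part K S s0.

Notation S0 := (coset_part K S s0).

Let K0 : 0 \in K. Proof. exact: sgK.1. Qed.
Let KB x y : x \in K -> y \in K -> x - y \in K. Proof. exact: sgK.2. Qed.
Let KD x y : x \in K -> y \in K -> x + y \in K. Proof. exact: subgroupD. Qed.

Lemma mem_part x s : (s \in coset_part K S x) = (s \in S) && (s - x \in K).
Proof. by rewrite !inE. Qed.

Lemma part_sub x : coset_part K S x `<=` S.
Proof. by apply/fsubsetP => s; rewrite mem_part => /andP[]. Qed.

Lemma part_shift x : coset_part K S x `<=` shift x K.
Proof. by apply/fsubsetP => s; rewrite mem_part mem_shift => /andP[]. Qed.

(** By [cK] the set [K + S] has at most [|K| - 1] points outside [S], and the holes of two distinct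
    cosets are among them. *)
Lemma card_parts s t : s \in S -> t \in S -> t - s \notin K ->
  (#|` K| + 1 <= #|` coset_part K S s| + #|` coset_part K S t|)%N.
Proof.
move=> sS tS nst; pose D := S `\` (coset_part K S s `|` coset_part K S t).
have c1 : (#|` shift s K| + #|` shift t K| <= #|` shift s K `|` shift t K|)%N.
  apply: leq_card_disjoint; rewrite ?fsubsetUl ?fsubsetUr //.
  apply/fdisjointP => z; rewrite !mem_shift => zs; apply: contra nst => zt.
  have -> : t - s = (z - s) - (z - t) by rewrite opprB [RHS]addrC addrA subrK.
  exact: KB.
have c2 : (#|` shift s K `|` shift t K| + #|` D| <= #|` fadd K S|)%N.
  apply: leq_card_disjoint.
  - by rewrite fsubUset faddC !shift_sub_faddl.
  - by apply: fsubset_trans (fadd_sub0l _ K0); apply: fsubsetDl.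
  apply/fdisjointP => z; rewrite !inE !mem_shift.
  by case/orP => zK; rewrite zK !andbT ?orbT //=;
    case: (z \in S) => //=; rewrite orbT.
have := cardfsID (coset_part K S s `|` coset_part K S t) S; rewrite -/D.
have := cardfsUI (coset_part K S s) (coset_part K S t).
have := fsubset_leq_card (fsubsetIr S (coset_part K S s `|` coset_part K S t)).
by move: c1 c2; rewrite !card_shift; lia.
Qed.

(** Minimality of [S0] lets [s] replace [s0] in [card_parts], even if [s] and [t] share a coset.
    Then [z - S_s] and [S_t] are too large to be disjoint in [t + K]. *)
Lemma pair_full s t z : s \in S -> t \in S -> t \notin S0 ->
  z - (s + t) \in K -> z \in fadd S S.
Proof.
move=> sS tS; rewrite mem_part tS /= => tS0 zK.
have := card_parts s0S tS tS0; have := min_s0 sS => c1 c2.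
apply: contrapT => /negP zN.
have : (#|` shift z (fopp (coset_part K S s))| + #|` coset_part K S t|
    <= #|` shift t K|)%N.
  apply: leq_card_disjoint; last 1 first.
  - apply/fdisjointP => u; rewrite mem_shift mem_fopp opprB => zu.
    apply: contra zN => ut; rewrite -(subrK u z).
    by apply: mem_fadd; apply: (fsubsetP (part_sub _)); [exact: zu|exact: ut].
  - apply/fsubsetP => u; rewrite !mem_shift mem_fopp opprB mem_part => /andP[_ uK].
    have -> : u - t = (z - (s + t)) - (z - u - s).
      by rewrite opprB opprB opprD [RHS]addrC !addrA subrK [s + u]addrC addrK.
    exact: KB.
  exact: part_shift.
by rewrite !card_shift card_fopp; lia.
Qed.

Lemma sum_full k s z' z : s \in S -> s \notin S0 -> z' \in fksum k.+1 S ->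
  z - (s + z') \in K -> z \in fksum k.+2 S.
Proof.
elim: k z' z => [|k IHk] z' z sS sS0.
  rewrite (fksumS 1) fksum1 => z'S zK; apply: (pair_full z'S sS) => //.
  by rewrite [z' + s]addrC.
rewrite fksumS => /faddP[t [u [tS uS ->]]] zK.
rewrite -[z](subrK t) addrC; apply: mem_fadd => //.
apply: (IHk u) => //.
by rewrite -addrA -opprD addrCA.
Qed.

Lemma sum_dichotomy k z : z \in fksum k.+2 S ->
  z \in fksum k.+2 S0 \/ forall h, h \in K -> h + z \in fksum k.+2 S.
Proof.
elim: k z => [|k IHk] _ /faddP[s [z' [sS z'S ->]]].
  have [s0'|sN] := boolP (s \in S0); last first.
    by right=> h hK; apply: (@sum_full 0 s z') => //; rewrite addrK.
  have {}z'S : z' \in S by rewrite -(fksum1 S).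
  have [z0'|zN] := boolP (z' \in S0).
    by left; rewrite fksumS fksum1 mem_fadd.
  right=> h hK; apply: (@sum_full 0 z' s) => //; first by rewrite fksum1.
  by rewrite [z' + s]addrC addrK.
have [s0'|sN] := boolP (s \in S0); last first.
  by right=> h hK; apply: (@sum_full k.+1 s z') => //; rewrite addrK.
case: (IHk _ z'S) => [z0'|zK]; first by left; apply: mem_fadd.
by right=> h hK; rewrite addrCA; apply: mem_fadd => //; apply: zK.
Qed.

Lemma mem_fksum_part j z : z \in fksum j S0 -> z - s0 *+ j \in K.
Proof.
elim: j z => [|j IHj] z; first by rewrite inE => /eqP->; rewrite subr0.
case/faddP => s [u [+ /IHj uK ->]]; rewrite mem_part => /andP[_ sK].
by rewrite mulrS opprD addrACA KD.
Qed.

Lemma mem_part_self : s0 \in S0. Proof. by rewrite mem_part s0S subrr. Qed.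

Lemma card_other_parts : (#|` fadd K (S `\` S0)| + #|` K| <= #|` fadd K S|)%N.
Proof.
rewrite -[#|` K|](card_shift s0); apply: leq_card_disjoint.
- by apply: faddS => //; apply: fsubsetDl.
- by rewrite faddC shift_sub_faddl.
apply/fdisjointP => z; rewrite mem_shift => /faddP[h [s [hK + ->]]].
rewrite inE mem_part => /andP[+ sS]; rewrite sS; apply: contra => hsK.
have -> : s - s0 = h + s - s0 - h by rewrite -[h + s - s0]addrA [RHS]addrC addKr.
exact: KB.
Qed.

(** The holes of [S0] are at most all the holes of [K + S]; equality means that [S] without [S0] is
    a union of cosets. *)
Lemma card_part_ge : (#|` S| + #|` K| <= #|` fadd K S| + #|` S0|)%N.
Proof.
have := card_other_parts; have := fsubset_leq_card (fadd_sub0l (S `\` S0) K0).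
have := fsubset_leq_card (part_sub s0).
by rewrite (cardfsDS (part_sub s0)); lia.
Qed.

Variable k : nat.
Hypothesis apS : forall x, x \in stab (fksum k.+2 S) -> x = 0.

Notation P := (fksum k.+2 S).
Notation P0 := (fksum k.+2 S0).
Notation c := (s0 *+ k.+2).

Lemma fksum_part_sub : P0 `<=` P. Proof. exact/fksum_mono/part_sub. Qed.

(** All other cosets met by [P] are full, so a full [c + K] would make every element of [K] a period
    of [P]. *)
Lemma coset_not_full : ~ forall h, h \in K -> c + h \in P.
Proof.
move=> cP; have [h hK h0] := card_gt1_ex 0 K2.
move/eqP: h0; apply; apply: apS; apply: stab_sub; apply/fsubsetP => z.
rewrite mem_shift => /sum_dichotomy[/mem_fksum_part zK|zP]; last first.
  by have := zP _ hK; rewrite addrC subrK.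
have -> : z = c + ((z - h - c) + h).
  by rewrite [z - h - c]addrAC subrK [RHS]addrC subrK.
by apply: cP; apply: KD.
Qed.

Lemma unique_sum s z' : s \in S -> s \notin S0 -> z' \in fksum k.+1 S ->
  c - (s + z') \notin K.
Proof.
move=> sS sN z'S; apply/negP => cz; apply: coset_not_full => h hK.
by apply: (sum_full sS sN z'S); rewrite addrAC KD.
Qed.

(** A period of [P0] lies in [K], and the remainder of [P] is made of full [K]-cosets, so it is a
    period of [P]. This lets Kneser's bound be applied to [S0]. *)
Lemma aperiodic_fksum_part x : x \in stab P0 -> x = 0.
Proof.
move=> xP0; have cP0 : c \in P0 by apply/mem_fksum/mem_part_self.
have xK : x \in K by have /mem_fksum_part := stab_mem xP0 cP0; rewrite addrK.
apply: apS; apply: stab_sub; apply/fsubsetP => z; rewrite mem_shift => zP.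
rewrite -[z](subrK x) addrC.
case: (sum_dichotomy zP) => [zP0|]; last exact.
by apply: (fsubsetP fksum_part_sub); apply: stab_mem.
Qed.

(** Outside [c + K] the set [P] is a union of cosets and avoids [P0], so saturation adds points only
    inside [c + K]. *)
Lemma card_fksum_part : (#|` fadd K P| + #|` P0| <= #|` P| + #|` K|)%N.
Proof.
have /fsubset_leq_card : fadd K P `<=` (P `\` P0) `|` shift c K.
  apply/fsubsetP => _ /faddP[h [z [hK zP ->]]]; rewrite !inE mem_shift.
  have [zc|zc] := boolP (z - c \in K).
    by rewrite -addrA KD ?orbT.
  have hzc : h + z - c \notin K.
    apply: contra zc => hzc; have -> : z - c = h + z - c - h.
      by rewrite -[h + z - c]addrA [RHS]addrC addKr.
    exact: KB.
  apply/orP; left; apply/andP; split.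
    by apply: contra hzc; apply: mem_fksum_part.
  case: (sum_dichotomy zP) => [/mem_fksum_part|]; last exact.
  by rewrite (negPf zc).
have := cardfsUI (P `\` P0) (shift c K); rewrite card_shift.
have := cardfsID P0 P.
have /fsetIidPr-> := fksum_part_sub; lia.
Qed.

Lemma pred_not_full : exists2 y, y \in L & y \notin fadd K (fksum k.+1 S).
Proof.
have [s sS sN] := nS; exists (c - s); first by rewrite rpredB ?rpredMn ?SL.
apply/negP => /faddP[h [z [hK zS E]]].
have /negP := unique_sum sS sN zS; apply.
by rewrite opprD addrA E addrK.
Qed.

Lemma not_full j : (j <= k.+1)%N ->
  exists2 y, y \in L & y \notin fadd K (fksum j S).
Proof.
move=> jk; apply: contrapT => nex.
have full i y : y \in L -> y \in fadd K (fksum (i + j) S).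
  elim: i y => [|i IHi] y yL.
    by apply: contrapT => /negP yN; apply: nex; exists y.
  rewrite addSn fksumS faddA [fadd K S]faddC -faddA -[y](subrK s0) addrC.
  by apply: mem_fadd => //; apply: IHi; apply: rpredB => //; apply: SL.
have [y yL] := pred_not_full.
by rewrite -(subnK jk) full.
Qed.

Lemma card_grow j : (exists2 y, y \in L & y \notin fadd K (fksum j.+1 S)) ->
  (#|` fadd K (fksum j S)| + #|` fadd K S|
    <= #|` fadd K (fksum j.+1 S)| + #|` K|)%N.
Proof.
rewrite fksumS [fadd S _]faddC faddA => y; apply: kappaK y.
  by move=> z /faddP[h [u [/KL hL /(fksum_zmod SL) uL ->]]]; apply: rpredD.
apply/fset0Pn; exists (0 + s0 *+ j); apply: mem_fadd => //.
exact: mem_fksum.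
Qed.

(** The last sum may fill [L], where [kappaK] says nothing. Unique expression replaces it: [c - D]
    is disjoint from [K + (k+1)S], and [|D| >= |K + S| - |K|]. *)
Lemma card_grow_last :
  (#|` fadd K (fksum k.+1 S)| + #|` fadd K S| <= #|` fadd K P| + #|` K|)%N.
Proof.
have [|full] := pselect (exists2 y, y \in L & y \notin fadd K P).
  exact: card_grow.
have {}full y : y \in L -> y \in fadd K P.
  by move=> yL; apply: contrapT => /negP yN; apply: full; exists y.
pose D := fadd K (S `\` S0).
have c1 : (#|` fadd K (fksum k.+1 S)| + #|` shift c (fopp D)| <= #|` fadd K P|)%N.
  apply: leq_card_disjoint.
  - apply/fsubsetP => z /faddP[h [u [/KL hL /(fksum_zmod SL) uL ->]]].
    by rewrite full ?rpredD.
  - apply/fsubsetP => z; rewrite mem_shift mem_fopp opprB => zD; apply: full.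
    rewrite -(subKr c z); apply: rpredB; first by rewrite rpredMn // SL.
    case/faddP: zD => h [s [/KL hL]]; rewrite inE => /andP[_ /SL sL] ->.
    exact: rpredD.
  apply/fdisjointP => z /faddP[h [u [hK uS zE]]].
  rewrite mem_shift mem_fopp opprB; apply/negP => /faddP[h' [s [h'K]]].
  rewrite inE => /andP[sN sS] E; have /negP := unique_sum sS sN uS; apply.
  have -> : c - (s + u) = h' + h.
    by apply/eqP; rewrite subr_eq addrACA -E -zE subrK.
  exact: KD.
have /fsubset_leq_card : fadd K S `<=` D `|` shift s0 K.
  apply/fsubsetP => _ /faddP[h [s [hK sS ->]]]; rewrite inE.
  have [sS0|sN] := boolP (s \in S0); last by rewrite mem_fadd // inE sN.
  move: sS0; rewrite mem_part => /andP[_ sK]; apply/orP; right.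
  by rewrite mem_shift -addrA KD.
have := cardfsUI D (shift s0 K); move: c1.
by rewrite !card_shift card_fopp; lia.
Qed.

(** The start [i] is left free: [i = 0] serves Kneser's bound, [i = 2] bounds [K + 2S] in the
    equality case. *)
Lemma card_ksum_ge i : (i <= k.+1)%N ->
  (#|` fadd K (fksum i S)| + (k.+2 - i) * #|` fadd K S|
    <= #|` fadd K P| + (k.+2 - i) * #|` K|)%N.
Proof.
move=> ik; have grow j : (i + j <= k.+1)%N ->
    (#|` fadd K (fksum i S)| + j * #|` fadd K S|
      <= #|` fadd K (fksum (i + j) S)| + j * #|` K|)%N.
  elim: j => [|j IHj] ijk; first by rewrite addn0.
  have := IHj (ltac:(lia)); rewrite addnS.
  have := card_grow (not_full (_ : ((i + j).+1 <= k.+1)%N)).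
  by move=> /(_ (ltac:(lia))); lia.
have := grow (k.+1 - i)%N; rewrite subnKC // => /(_ (leqnn _)).
have -> : (k.+2 - i = (k.+1 - i).+1)%N by lia.
by have := card_grow_last; lia.
Qed.

End Decomposition.

(** Induction on [|S|] through a 1-atom [K] that is a subgroup. If [K] is trivial, each new summand
    adds at least [|S| - 1] points; otherwise the bound for the smaller set [S_0] is combined with
    the growth modulo [K]. *)
Lemma kneser_fksum k S : S != fset0 ->
  (forall x, x \in stab (fksum k S) -> x = 0) ->
  (k * #|` S| + 1 <= #|` fksum k S| + k)%N.
Proof.
case: k => [|[|k]]; [by rewrite cardfs1|by rewrite fksum1; lia|].
have [n] := ubnP #|` S|; elim: n S => // n IHn S; rewrite ltnS => leSn Sn0 apS.
case/fset0Pn: (Sn0) => x xS.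
pose T := shift (- x) S.
have T0 : 0 \in T by rewrite mem_shift sub0r opprK.
have cT : #|` T| = #|` S| by rewrite card_shift.
have apT y : y \in stab (fksum k.+2 T) -> y = 0.
  by rewrite fksum_shift stab_shift; apply: apS.
have <- : #|` fksum k.+2 T| = #|` fksum k.+2 S| by rewrite fksum_shift card_shift.
rewrite -cT in leSn *; move: T T0 cT apT leSn => {xS apS Sn0 x S} S S0 _ apS leSn.
have Sn0 : S != fset0 by apply/fset0Pn; exists 0.
have ksn0 j : fksum j S != fset0 by apply: fksum_neq0.
have [S1|S2] := leqP #|` S| 1.
  by have := ksn0 k.+2; rewrite -cardfs_gt0; nia.
have [L [SL genL]] := gen_exists S.
have ksL j : {subset fksum j S <= L} by apply: fksum_zmod.
(* If [kS] covered [L], any non-zero element of [S] would be a period of it. *)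
have [y yL yN] : exists2 y, y \in L & y \notin fksum k.+2 S.
  apply: contrapT => nex; have [s sS s0] := card_gt1_ex 0 S2.
  move/eqP: s0; apply; apply: apS; apply: stab_sub; apply/fsubsetP => z.
  rewrite mem_shift => /ksL zL; apply: contrapT => /negP zN; apply: nex.
  by exists z => //; rewrite -[z](subrK s) rpredD // SL.
have sub_ks j : (j <= k.+2)%N -> fksum j S `<=` fksum k.+2 S.
  move=> /subnK <-; elim: (k.+2 - j)%N => [//|i IHi].
  by rewrite addSn fksumS; apply: (fsubset_trans IHi); apply: fadd_sub0l.
have omits1 Z : (exists2 u, u \in L & u \notin Z) -> omits L 1 Z.
  move=> [u uL uZ]; exists [fset u]; split; rewrite ?cardfs1 //.
    by move=> v; rewrite inE => /eqP->.
  by rewrite fdisjoint1X.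
have a0 : admissible L 1 S [fset 0].
  split; rewrite ?cardfs1 //.
    by move=> v; rewrite inE => /eqP->; rewrite rpred0.
  apply: omits1; exists y => //; rewrite fadd0l; apply: contra yN.
  by rewrite -{1}[S]fksum1; apply: (fsubsetP (sub_ks 1%N _)).
have [K atK K0] := atom_exists (ltn0Sn 0) Sn0 a0.
have sgK := atom1_subgroup SL atK K0.
have [[KL _ oK] mK] := atK.
have kappaK X : {subset X <= L} -> X != fset0 ->
    (exists2 u, u \in L & u \notin fadd X S) ->
    (#|` X| + #|` fadd K S| <= #|` fadd X S| + #|` K|)%N.
  move=> XL X0 /omits1 oX.
  have aX : admissible L 1 S X by split; rewrite ?cardfs_gt0.
  by have := (mK _ aX).1; lia.
have cK : (#|` fadd K S| + 1 <= #|` S| + #|` K|)%N.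
  by have := (mK _ a0).1; rewrite fadd0l cardfs1; lia.
have [K1|K2] := leqP #|` K| 1.
  have grow j : (j <= k.+2)%N -> (j * #|` S| + 1 <= #|` fksum j S| + j)%N.
    elim: j => [|j IHj] jk; first by rewrite cardfs1.
    have Kn0 : K != fset0 by apply/fset0Pn; exists 0.
    have := Kn0; rewrite -cardfs_gt0; have := leq_card_fadd S Kn0.
    have := kappaK _ (@ksL j) (ksn0 j); rewrite faddC -fksumS => kap.
    have := kap (ex_intro2 _ _ y yL (contra (fsubsetP (sub_ks j.+1 jk) y) yN)).
    by have := IHj (ltnW jk); lia.
  by have := grow k.+2 (leqnn _).
have [t tS tK] : exists2 t, t \in S & t \notin K.
  apply: contrapT => nex; have [M MK] := subgroup_zmod sgK.
  have LM : {subset L <= M}.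
    apply: genL => a aS; rewrite MK; apply: contrapT => /negP aK.
    by apply: nex; exists a.
  case: oK => Y [YL]; rewrite cardfs_gt0 => /fset0Pn[u uY] /fdisjointP/(_ _ uY).
  by rewrite -[u]addr0 mem_fadd // -MK LM // YL.
have [s0 s0S min_s0] := @exists_min_nat G (fun s => s \in S)
  (fun s => #|` coset_part K S s|) (ex_intro _ 0 S0).
have nS : exists2 s, s \in S & s \notin coset_part K S s0.
  apply: contrapT => nex; have all s : s \in S -> s - s0 \in K.
    move=> sS; apply: contrapT => /negP sN; apply: nex; exists s => //.
    by rewrite mem_part sS.
  case/negP: tK; have -> : t = (t - s0) - (0 - s0) by rewrite sub0r opprK subrK.
  by apply: sgK.2; apply: all.
pose S1 := coset_part K S s0.
have apP0 := aperiodic_fksum_part sgK K2 cK s0S min_s0 apS.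
have cP := card_fksum_part sgK K2 cK s0S min_s0 k.
have gr := card_ksum_ge SL KL sgK K2 cK kappaK s0S min_s0 nS apS (leq0n _).
have ltS1 : (#|` S1| < #|` S|)%N.
  apply: fproper_ltn_card; rewrite fproperEneq part_sub andbT.
  by case: nS => s sS; apply: contraNneq => E; rewrite -/S1 E.
have S1n0 : S1 != fset0 by apply/fset0Pn; exists s0; apply: mem_part_self.
have := IHn S1 (leq_trans ltS1 leSn) S1n0 apP0.
have cS1 : (#|` S| + #|` K| <= #|` fadd K S| + #|` S1|)%N by apply: card_part_ge.
have := leq_mul (leqnn k.+2) cS1; rewrite !mulnDr.
move: gr cP; rewrite -/S1 subn0 [fadd K (fksum 0 S)]faddC fadd0l; clear; lia.
Qed.

End Ksums.

(** * Small sets and complements *)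

Section SmallSets.
Variable G : zmodType.
Local Open Scope fset_scope.
Local Open Scope ring_scope.
Implicit Types (A B S X Y K : {fset G}) (x y z : G).

Lemma small_progression S : S != fset0 -> (#|` S| <= 2)%N -> progression S.
Proof.
case/fset0Pn => a aS S2; have [E|[b]] := fset_0Vmem (S `\ a).
  exists a, 0, 1%N; split=> // x; split=> [xS|[i _ ->]]; last first.
    by rewrite mul0rn addr0.
  exists 0%N; rewrite ?addr0 //; apply/eqP/negPn/negP => xa.
  by have := in_fset0 x; rewrite -E !inE xa xS.
rewrite !inE => /andP[ba bS]; exists a, (b - a), 2%N; split=> // x.
have SE : S = [fset a; b].
  apply/esym/eqP; rewrite eqEfcard cardfs2 [a == b]eq_sym ba S2 andbT.
  by apply/fsubsetP => y; rewrite !inE => /orP[]/eqP->.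
rewrite SE !inE; split=> [/orP[]/eqP->|[[|[|i]] // _ ->]].
- by exists 0%N; rewrite ?addr0.
- by exists 1%N; rewrite // mulr1n addrC subrK.
- by rewrite addr0 eqxx.
by rewrite mulr1n addrC subrK eqxx orbT.
Qed.

Lemma notin_fksum_le j k S s y : s \in S -> (j <= k)%N -> y \notin fksum k S ->
  y - s *+ (k - j) \notin fksum j S.
Proof.
move=> sS /subnKC {1}<-; elim: (k - j)%N y => [|i IHi] y.
  by rewrite addn0 subr0.
rewrite addnS fksumS => yN; rewrite mulrS opprD addrA; apply: IHi.
by apply: contra yN => yS; rewrite -[y](subrK s) addrC mem_fadd.
Qed.

Lemma card_fksum_grow k S y i j :
    (forall X, X != fset0 -> (exists y, y \notin fadd X S) ->
      (#|` X| + #|` S| <= #|` fadd X S| + 1)%N) ->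
    S != fset0 -> y \notin fksum k S -> (i + j <= k)%N ->
  (#|` fksum i S| + j * #|` S| <= #|` fksum (i + j) S| + j)%N.
Proof.
move=> kap Sn0 yN; elim: j => [|j IHj] ijk; first by rewrite !addn0.
have [s sS] : exists s, s \in S by apply/fset0Pn.
have := kap _ (fksum_neq0 (i + j) Sn0).
rewrite faddC -fksumS -addnS.
have yN' : exists y, y \notin fksum (i + j.+1) S.
  by exists (y - s *+ (k - (i + j.+1))); apply: notin_fksum_le.
move=> /(_ yN'); by have := IHj (ltac:(lia)); lia.
Qed.

(** [x - S] avoids [S] because [x] is not in [S + S]; having total size [|F|], the two sets
    partition [F]. *)
Lemma card_sub_complement S F x : (forall y, y \in F) ->
  x \notin fadd S S -> #|` F| = (2 * #|` S|)%N ->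
  forall y, (y \in S) = (x - y \notin S).
Proof.
move=> FT xN cF y; apply/idP/idP => [yS|yN].
  by apply: contra xN => xyS; rewrite -(subrK y x) mem_fadd.
pose R := shift x (fopp S).
have RS : R = F `\` S.
  apply/eqP; rewrite eqEfcard card_shift card_fopp cardfsDS ?cF.
    apply/andP; split; last by lia.
    apply/fsubsetP => z; rewrite mem_shift mem_fopp opprB => zS.
    rewrite inE FT andbT; apply: contra xN => zS'.
    by rewrite -(subrK z x) mem_fadd.
  by apply/fsubsetP => z _; apply: FT.
have : y \notin R -> y \in S by rewrite RS inE FT andbT negbK.
by apply; rewrite mem_shift mem_fopp opprB.
Qed.

End SmallSets.

(** * Passage to the quotient by a finite subgroup *)

Section Projection.
Variables (G Q : zmodType) (f : G -> Q) (g : Q -> G) (K : {fset G}).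
Local Open Scope fset_scope.
Local Open Scope ring_scope.
Hypothesis fD : forall x y, f (x + y) = f x + f y.
Hypothesis gK : forall q, f (g q) = q.
Hypothesis fK : forall x y, f x = f y <-> x - y \in K.
Hypothesis K0 : 0 \in K.
Implicit Types (A B S X : {fset G}) (Y : {fset Q}).

Definition proj X : {fset Q} := [fset f x | x in X].

(** The preimage of [Y] under [f], written as a sumset so that it is a finite set by
    construction. *)
Definition saturation Y : {fset G} := fadd K [fset g q | q in Y].

Lemma projK0 x : (x \in K) = (f x == 0).
Proof.
have f0 : f 0 = 0 by apply: (addrI (f 0)); rewrite -fD !addr0.
apply/idP/eqP => [xK|]; first by rewrite -f0; apply/fK; rewrite subr0.
by rewrite -f0 => /fK; rewrite subr0.
Qed.

Lemma mem_saturation Y x : (x \in saturation Y) = (f x \in Y).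
Proof.
apply/faddP/idP => [[h [z [hK /imfsetP[q /= qY ->] ->]]]|xY].
  by move: hK; rewrite projK0 fD gK => /eqP->; rewrite add0r.
exists (x - g (f x)), (g (f x)); split; last by rewrite subrK.
  by apply/fK; rewrite gK.
by apply/imfsetP; exists (f x).
Qed.

Lemma saturation_proj X : saturation (proj X) = fadd K X.
Proof.
apply/fsetP => z; rewrite mem_saturation; apply/imfsetP/faddP => [[x /= xX E]|].
  by exists (z - x), x; rewrite subrK; split=> //; apply/fK.
move=> [h [x [hK xX ->]]]; exists x => //.
by move: hK; rewrite projK0 fD => /eqP->; rewrite add0r.
Qed.

Lemma proj_fadd A B : proj (fadd A B) = fadd (proj A) (proj B).
Proof.
apply/fsetP => q; apply/imfsetP/faddP.
  move=> [x /= /faddP[a [b [aA bB ->]]] ->]; exists (f a), (f b).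
  by split; rewrite ?fD //; apply/imfsetP; [exists a|exists b].
move=> [_ [_ [/imfsetP[a /= aA ->] /imfsetP[b /= bB ->] ->]]].
by exists (a + b); rewrite ?fD ?mem_fadd.
Qed.

Lemma proj_saturation Y : proj (saturation Y) = Y.
Proof.
apply/fsetP => q; apply/imfsetP/idP => [[x /=]|qY].
  by rewrite mem_saturation => + ->.
by exists (g q); rewrite ?gK //= mem_saturation gK.
Qed.

Lemma saturation_fadd Y S : fadd (saturation Y) S = saturation (fadd Y (proj S)).
Proof.
have -> : fadd Y (proj S) = proj (fadd (saturation Y) S).
  by rewrite proj_fadd proj_saturation.
rewrite saturation_proj faddA -[in RHS](saturation_proj (saturation Y)).
by rewrite proj_saturation.
Qed.

Lemma card_saturation Y : #|` saturation Y| = (#|` Y| * #|` K|)%N.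
Proof.
have [n] := ubnP #|` Y|; elim: n Y => // n IHn Y; rewrite ltnS => leYn.
have [->|[q qY]] := fset_0Vmem Y.
  rewrite cardfs0 mul0n; apply/eqP; rewrite cardfs_eq0; apply/eqP/fsetP => x.
  by rewrite mem_saturation !inE.
have cY : #|` Y| = (#|` Y `\ q|).+1 by rewrite (cardfsD1 q) qY.
have := IHn (Y `\ q) (ltac:(lia)).
have LY : saturation Y = shift (g q) K `|` saturation (Y `\ q).
  apply/fsetP => x; rewrite !inE mem_shift !mem_saturation !inE.
  have -> : (x - g q \in K) = (f x == q).
    by apply/idP/eqP => [/fK|E]; [|apply/fK]; rewrite gK.
  by case: eqP => // ->.
have D0 : shift (g q) K `&` saturation (Y `\ q) = fset0.
  apply/fsetP => x; rewrite !inE mem_shift mem_saturation !inE.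
  by apply/negP => /andP[/fK ->]; rewrite gK eqxx.
have := cardfsUI (shift (g q) K) (saturation (Y `\ q)).
rewrite D0 cardfs0 addn0 -LY card_shift => -> ->.
by rewrite cY mulSn.
Qed.

Lemma card_proj X : #|` fadd K X| = (#|` proj X| * #|` K|)%N.
Proof. by rewrite -saturation_proj card_saturation. Qed.

(** Preimages multiply all sizes by [|K|], so the excess bounds descend to [proj S]. A non-trivial
    subgroup violating the second Vosper hypothesis would pull back to a fragment strictly larger
    than [K], against [maxK]. *)
Lemma proj_progression S : subgroup K -> S != fset0 ->
    (forall X, X != fset0 -> (exists y, y \notin fadd X S) ->
      (#|` X| + #|` fadd K S| <= #|` fadd X S| + #|` K|)%N) ->
    (forall K', subgroup K' -> K `<=` K' -> (exists y, y \notin fadd K' S) ->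
      (#|` fadd K' S| + #|` K| <= #|` fadd K S| + #|` K'|)%N -> K' = K) ->
    (#|` fadd K (fadd S S)| + #|` K| <= 2 * #|` fadd K S|)%N ->
    omits (@full_zmod Q : zmodClosed Q) 2 (fadd (proj S) (proj S)) ->
  progression (proj S).
Proof.
move=> sgK Sn0 kap maxK cSS oT; set T := proj S.
have K_gt0 : (0 < #|` K|)%N by rewrite cardfs_gt0; apply/fset0Pn; exists 0.
have Tn0 : T != fset0.
  case/fset0Pn: Sn0 => s sS; apply/fset0Pn; exists (f s).
  by apply/imfsetP; exists s.
have [T2|T3] := leqP #|` T| 2; first exact: small_progression.
have cKS := card_proj S; rewrite -/T in cKS.
have cT Y : #|` fadd (saturation Y) S| = (#|` fadd Y T| * #|` K|)%N.
  by rewrite saturation_fadd card_saturation.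
have missing Y : (exists q, q \notin fadd Y T) ->
    exists y, y \notin fadd (saturation Y) S.
  by move=> [q qN]; exists (g q); rewrite saturation_fadd mem_saturation gK.
apply: vosper_progression => //.
- move=> Y /fset0Pn[q qY] /missing mY.
  have Xn0 : saturation Y != fset0.
    by apply/fset0Pn; exists (g q); rewrite mem_saturation gK.
  have := kap _ Xn0 mY; rewrite cT cKS card_saturation -mulnDl -mulSnr.
  by rewrite leq_pmul2r // addn1.
- move=> Y [Y0 YB] Y2 /missing mY; rewrite leqNgt; apply/negP => ltY.
  have fB x y : f (x - y) = f x - f y.
    by apply/eqP; rewrite eq_sym subr_eq -fD subrK.
  have sgX : subgroup (saturation Y).
    split=> [|x y]; last by rewrite !mem_saturation fB; apply: YB.
    by rewrite mem_saturation (eqP (_ : f 0 == 0)) // -projK0.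
  have KX : K `<=` saturation Y.
    by apply/fsubsetP => x; rewrite projK0 mem_saturation => /eqP->.
  have := maxK _ sgX KX mY; rewrite cT cKS card_saturation.
  rewrite -mulSnr -mulnDl leq_pmul2r //.
  rewrite [(#|` T| + _)%N]addnC => /(_ ltY) XK.
  have := card_saturation Y; rewrite XK.
  by move=> E; have := leq_mul Y2 (leqnn #|` K|); rewrite -E; lia.
- by lia.
rewrite -proj_fadd; move: cSS.
by rewrite (card_proj (fadd S S)) cKS -mulSnr mulnA leq_pmul2r // addn1.
Qed.

End Projection.

(** * From the set-theoretic definitions to finite sets *)

Section Bridge.
Variable G : zmodType.
Implicit Types (A B S X K : {fset G}).

Lemma sumset_fset A B : sumset [set` A] [set` B] = [set` fadd A B].
Proof.
apply/seteqP; split=> [x /= [a aA [b bB <-]]|x /= /faddP[a [b [aA bB ->]]]].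
  exact: mem_fadd.
by exists a => //; exists b.
Qed.

Lemma ksum_fset k A : ksum k [set` A] = [set` fksum k A].
Proof.
elim: k => [|k IHk]; first by apply/seteqP; split=> x /=; rewrite inE => /eqP.
by rewrite /ksum iterS -/(ksum k _) IHk sumset_fset.
Qed.

Lemma setcard_fset A : setcard [set` A] = #|` A|.
Proof. by rewrite /setcard set_fsetK. Qed.

Lemma aperiodic_fset A : aperiodic [set` A] -> forall x, x \in stab A -> x = 0.
Proof.
move=> ap x /eqP xA; suff : [set x | sumset [set x] [set` A] = [set` A]] x.
  by rewrite ap.
rewrite /= -{2}xA -fadd1 -sumset_fset; congr sumset.
by apply/seteqP; split=> y /=; rewrite inE => /eqP.
Qed.

Lemma neq_setT_fset A : [set` A] <> [set: G] <-> exists y, y \notin A.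
Proof.
split=> [nA|[y /negP yA] AT]; last by apply: yA; have : [set` A] y by rewrite AT.
apply: contrapT => nex; apply: nA; apply/seteqP; split=> y //= _.
by apply: contrapT => /negP yA; apply: nex; exists y.
Qed.

Lemma kappa1_admissible_fset S X : kappa1_admissible [set` S] [set` X] <->
  X != fset0 /\ exists y, y \notin fadd X S.
Proof.
rewrite -neq_setT_fset -sumset_fset; split=> [[_ [x xX] ?]|[/fset0Pn[x xX] ?]].
  by split=> //; apply/fset0Pn; exists x.
by split=> //; exists x.
Qed.

Lemma deficiency_fset S X : S != fset0 ->
  deficiency [set` S] [set` X] = (#|` fadd X S| - #|` X|)%N%:Z.
Proof.
move=> S0; rewrite /deficiency sumset_fset !setcard_fset subzn //.
by rewrite faddC leq_card_fadd.
Qed.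

Lemma is_fragment_fset S K : S != fset0 ->
  is_fragment [set` S] [set` K] <->
  [/\ K != fset0, exists y, y \notin fadd K S &
    forall X, X != fset0 -> (exists y, y \notin fadd X S) ->
      (#|` X| + #|` fadd K S| <= #|` fadd X S| + #|` K|)%N].
Proof.
move=> S0; have leS X : (#|` X| <= #|` fadd X S|)%N by rewrite faddC leq_card_fadd.
(* Deficiencies of admissible sets are natural numbers, so a least one exists and the default value
   of [xget] is not taken. *)
have kap : forall X, kappa1_admissible [set` S] [set` X] ->
    (kappa1_values [set` S] `&` lbound (kappa1_values [set` S]))
      (kappa1 [set` S]).
  move=> X aX; apply: xgetPex.
  have [M aM mM] := @exists_min_nat _ (fun X => kappa1_admissible [set` S] [set` X])
    (fun X => (#|` fadd X S| - #|` X|)%N) (ex_intro _ X aX).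
  exists (deficiency [set` S] [set` M]); split; first by exists [set` M].
  move=> _ [Y aY <-]; have [/finite_fsetP[Z YZ] _ _] := aY.
  by rewrite YZ in aY *; rewrite !deficiency_fset // lez_nat; apply: mM.
split=> [[aK dK]|[K0 mK minK]].
  have [K0 mK] := (kappa1_admissible_fset S K).1 aK; split=> // X X0 mX.
  have aX : kappa1_admissible [set` S] [set` X] by apply/kappa1_admissible_fset.
  have /(_ (deficiency [set` S] [set` X])) := (kap _ aK).2; rewrite -dK.
  rewrite !deficiency_fset // lez_nat => le_def.
  have {}le_def := le_def (ex_intro2 _ _ [set` X] aX (deficiency_fset X S0)).
  by have := leS X; have := leS K; lia.
have aK : kappa1_admissible [set` S] [set` K] by apply/kappa1_admissible_fset.
split=> //; have [[Y aY dY] lbK] := kap _ aK.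
apply: le_anti; rewrite (lbK (deficiency _ _)) ?andbT; last by exists [set` K].
rewrite -dY; have [/finite_fsetP[Z YZ] _ _] := aY; rewrite YZ in aY *.
have [Z0 mZ] := (kappa1_admissible_fset S Z).1 aY.
have := minK _ Z0 mZ; rewrite !deficiency_fset // lez_nat.
by have := leS Z; have := leS K; lia.
Qed.

Lemma arith_prog_fset S : progression S -> arith_prog [set` S].
Proof.
move=> [a [d [m [m0 SP]]]]; exists a, d, m; split=> //.
apply/seteqP; split=> x /=; first by move=> /SP[i im ->]; exists i.
by move=> [i im <-]; apply/SP; exists i.
Qed.

End Bridge.

(** * Trivial and non-trivial hyper-atoms *)

Section HyperAtoms.
Variable G : zmodType.
Local Open Scope fset_scope.
Local Open Scope ring_scope.
Implicit Types (A B S X F K : {fset G}) (x y z : G).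

(** As [S] is not a progression, the Vosper-type theorem must fail for lack of room: [S + S] misses
    exactly one point, so the group is finite. *)
Lemma trivial_hyper_atom k S :
    (forall X, X != fset0 -> (exists y, y \notin fadd X S) ->
      (#|` X| + #|` S| <= #|` fadd X S| + 1)%N) ->
    (forall K, subgroup K -> (2 <= #|` K|)%N -> (exists y, y \notin fadd K S) ->
      (#|` K| + #|` S| <= #|` fadd K S|)%N) ->
    S != fset0 -> ~ progression S -> (exists y, y \notin fksum k.+2 S) ->
    (#|` fksum k.+2 S| + k.+2 = k.+2 * #|` S| + 1)%N ->
  exists F, [/\ forall y, y \in F, #|` F| = (#|` fadd S S|).+1,
    #|` F| = (2 * #|` S|)%N & k = 0%N].
Proof.
move=> HX HK Sn0 nAP [y0 y0N] cP.
have S3 : (2 < #|` S|)%N.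
  by rewrite ltnNge; apply/negP => S2; apply: nAP; apply: small_progression.
have E2 : fksum 2 S = fadd S S by rewrite fksumS fksum1.
have [s sS] : exists s, s \in S by apply/fset0Pn.
have missing j : (j <= k.+2)%N -> exists y, y \notin fksum j S.
  by move=> jk; exists (y0 - s *+ (k.+2 - j)); apply: notin_fksum_le.
have [y1] : exists y, y \notin fksum 2 S by apply: missing.
rewrite E2 => y1N; have lo := HX S Sn0 (ex_intro _ y1 y1N).
have := @card_fksum_grow _ k.+2 S y0 2 k HX Sn0 y0N (leqnn _).
rewrite E2 add2n => hi.
have full y : y \in y1 |` fadd S S.
  apply: contrapT => /negP; rewrite !inE negb_or => /andP[yy1 yN].
  apply: nAP; apply: vosper_progression => //; [by lia|by lia|].
  exists [fset y; y1]; split=> //; first by rewrite cardfs2 yy1.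
  by apply/fdisjointP => z; rewrite !inE => /orP[]/eqP->.
have cF : #|` y1 |` fadd S S| = (#|` fadd S S|).+1 by rewrite cardfsU1 y1N.
exists (y1 |` fadd S S); split=> //; first by lia.
(* With three summands or more, [3S] also misses a point, so [|3S| <= |2S|], although
   [|3S| >= |2S| + |S| - 1]. *)
case: k cP y0N missing {hi} => // k cP y0N missing; exfalso.
have [y2 y2N] := missing 3%N isT.
have : fksum 3 S `<=` (y1 |` fadd S S) `\ y2.
  apply/fsubsetP => z zS; rewrite !inE -in_fset1U full andbT.
  by apply: contraNneq y2N => <-.
have g3 : (#|` fadd S S| + #|` S| <= #|` fksum 3 S| + 1)%N.
  by have := @card_fksum_grow _ k.+3 S y0 2 1 HX Sn0 y0N isT; rewrite E2 mul1n.
move/fsubset_leq_card; have := cardfsD1 y2 (y1 |` fadd S S); rewrite full cF.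
by move=> c3 c4; lia.
Qed.

(** The inequalities whose sum is Kneser's bound are all equalities here: the one for holes makes
    [S] without [S_0] periodic, the one for [S_0] is its own critical equation. *)
Lemma critical_decomposition k S K s0 :
    subgroup K -> (2 <= #|` K|)%N ->
    (#|` fadd K S| + 1 <= #|` S| + #|` K|)%N ->
    (forall X, X != fset0 -> (exists y, y \notin fadd X S) ->
      (#|` X| + #|` fadd K S| <= #|` fadd X S| + #|` K|)%N) ->
    s0 \in S ->
    (forall s, s \in S ->
      (#|` coset_part K S s0| <= #|` coset_part K S s|)%N) ->
    (exists2 s, s \in S & s \notin coset_part K S s0) ->
    (forall x, x \in stab (fksum k.+2 S) -> x = 0) ->
    (#|` fksum k.+2 S| + k.+2 = k.+2 * #|` S| + 1)%N ->
  [/\ fadd K (S `\` coset_part K S s0) = S `\` coset_part K S s0,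
    (#|` fksum k.+2 (coset_part K S s0)| + k.+2 =
      k.+2 * #|` coset_part K S s0| + 1)%N &
    (0 < k)%N ->
      (#|` fadd K (fadd S S)| + #|` K| <= 2 * #|` fadd K S|)%N].
Proof.
move=> sgK K2 cK kap s0S min_s0 nS apS cP; set S0 := coset_part K S s0.
have kapL X : {subset X <= (@full_zmod G : zmodClosed G)} -> X != fset0 ->
    (exists2 y, y \in (@full_zmod G : zmodClosed G) & y \notin fadd X S) ->
    (#|` X| + #|` fadd K S| <= #|` fadd X S| + #|` K|)%N.
  by move=> _ X0 [y _ yN]; apply: kap => //; exists y.
have SL : {subset S <= (@full_zmod G : zmodClosed G)} by [].
have KL : {subset K <= (@full_zmod G : zmodClosed G)} by [].
have ge i (ik : (i <= k.+1)%N) :=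
  card_ksum_ge SL KL sgK K2 cK kapL s0S min_s0 nS apS ik.
have cPK := card_fksum_part sgK K2 cK s0S min_s0 k; rewrite -/S0 in cPK.
have S0n0 : S0 != fset0 by apply/fset0Pn; exists s0; apply: mem_part_self.
have kn := kneser_fksum S0n0 (aperiodic_fksum_part sgK K2 cK s0S min_s0 apS).
have cS0 : (#|` S| + #|` K| <= #|` fadd K S| + #|` S0|)%N by apply: card_part_ge.
have cS0k := leq_mul (leqnn k.+2) cS0; rewrite !mulnDr in cS0k.
have ge0 := ge 0%N (leq0n _).
rewrite subn0 [fadd K (fksum 0 S)]faddC fadd0l in ge0.
have eqk : (k.+2 * (#|` fadd K S| + #|` S0|) = k.+2 * (#|` S| + #|` K|))%N.
  by rewrite !mulnDr; lia.
have eqS : (#|` fadd K S| + #|` S0| = #|` S| + #|` K|)%N.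
  by apply/eqP; rewrite -(eqn_pmul2l (ltn0Sn k.+1)) eqk.
split; [|by lia|].
- apply/esym/eqP; rewrite eqEfcard fadd_sub0l ?sgK.1 // andTb.
  have := card_other_parts sgK s0S; rewrite -/S0 cardfsDS ?part_sub //.
  by have := fsubset_leq_card (part_sub S K s0); rewrite -/S0; lia.
(* Equality gives [|K + P| <= (k+2)(|K + S| - |K|) + |K|]; growth from [2S] on accounts for [k] of
   the steps, leaving two for [K + 2S]. *)
move=> k0; have := ge 2%N k0; rewrite [fksum 2 S]fksumS fksum1.
rewrite -addn2 addnK addn2 in cS0k eqk *.
by move: cS0k eqk; rewrite !mulnDr; lia.
Qed.

(** Maximality becomes an inequality: a larger proper candidate whose excess does not exceed that of
    [K] is again a fragment. *)
Lemma hyper_atom_fset S (H : zmodClosed G) : S != fset0 ->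
  is_hyper_atom [set` S] H ->
  exists K, [/\ H =i K, exists y, y \notin fadd K S,
    forall X, X != fset0 -> (exists y, y \notin fadd X S) ->
      (#|` X| + #|` fadd K S| <= #|` fadd X S| + #|` K|)%N &
    forall K', subgroup K' -> K `<=` K' -> (exists y, y \notin fadd K' S) ->
      (#|` fadd K' S| + #|` K| <= #|` fadd K S| + #|` K'|)%N -> K' = K].
Proof.
move=> Sn0 [frH maxH]; have [[/exists_zmod_fset[K HK] _ _] _] := frH.
have setE (L : zmodClosed G) B : L =i B -> [set` L] = [set` B].
  by move=> LB; apply/seteqP; split=> x /=; rewrite LB.
rewrite (setE H K HK) in frH.
have [K0 mK kap] := (is_fragment_fset K Sn0).1 frH.
exists K; split=> // K' sgK' KK' mK' leK'.
have [M MK'] := subgroup_zmod sgK'.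
have := maxH M; rewrite (setE _ _ MK') (setE _ _ HK) => max.
have /max E : is_fragment [set` S] [set` K'].
  apply/(is_fragment_fset K' Sn0); split=> //.
    by apply/fset0Pn; exists 0; case: sgK'.
  by move=> X X0 mX; have := kap X X0 mX; lia.
apply: (can_inj (@set_fsetK G)); apply: E.
by move=> x; apply: (fsubsetP KK').
Qed.

End HyperAtoms.

Theorem theorem17 (k : nat) (G : zmodType) (S : set G)
    (H : zmodClosed G) (S0 : set G) :
  (2 <= k)%N ->
  finite_set S ->
  S !=set0 ->
  generates (diffset S S) ->
  ~ arith_prog S ->
  aperiodic (ksum k S) ->
  setcard (ksum k S) = (k * setcard S - k + 1)%N ->
  is_hyper_atom S H ->
  is_smallest_component H S S0 ->
  let phi := canonical_morphism H in
  [/\ (~ ([set: G] #= `I_(setcard (ksum 2 S)).+1) -> (2 <= setcard [set` H])%N),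
      sumset (S `\` S0) [set` H] = S `\` S0 /\
      setcard (ksum k S0) = (k * setcard S0 - k + 1)%N
    & arith_prog (phi @` S) \/
      (k = 2%N /\
       ((exists x : G, S = [set x - a | a in ~` S]) \/
        diffset (phi @` S) (phi @` S0) `&` diffset (phi @` S0) (phi @` S)
          = [set phi 0]))].
Proof.
case: k => [//|[//|k]] _ /finite_fsetP[{}S ->] [s1 s1S] genS nAP.
rewrite !ksum_fset !setcard_fset => apS cS hypH [[[s0 S0s0] [x0 S0E]] minS0] phi.
have Sn0 : S != fset0 by apply/fset0Pn; exists s1.
have {}apS := aperiodic_fset apS.
have {}nAP : ~ progression S by move/arith_prog_fset.
have S3 : (2 < #|` S|)%N.
  by rewrite ltnNge; apply/negP => S2; apply: nAP; apply: small_progression.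
have {}cS : (#|` fksum k.+2 S| + k.+2 = k.+2 * #|` S| + 1)%N.
  by rewrite cS; have := leq_mul (leqnn k.+2) (ltnW (ltnW S3)); lia.
have mP : exists y, y \notin fksum k.+2 S.
  apply: contrapT => nex; have [s sS s_neq0] := card_gt1_ex 0 (ltnW S3).
  move/eqP: s_neq0; apply; apply: apS; apply: stab_sub; apply/fsubsetP => y _.
  by apply: contrapT => /negP yN; apply: nex; exists y.
have [K [HK mK kap maxK]] := hyper_atom_fset Sn0 hypH.
have sgK := zmod_subgroup HK.
have HKE : [set` H] = [set` K] by apply/seteqP; split=> x /=; rewrite HK.
have cosetE (C : set G) x z : C = [set` S] `&` sumset [set x] [set` H] -> C z ->
    C = [set` coset_part K S z].
  move=> -> [zS [_ -> [h /= hH zE]]]; apply/seteqP; split=> y /=.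
    rewrite mem_part => -[-> [_ -> [h' /= h'H <-]]] /=.
    by rewrite -HK -zE opprD addrACA subrr add0r rpredB.
  rewrite mem_part => /andP[yS yK]; split=> //; exists x => //.
  exists (h + (y - z)); first by rewrite /= rpredD // HK.
  by rewrite addrA zE addrC subrK.
have S0S : S0 = [set` coset_part K S s0] by apply: cosetE S0E S0s0.
have s0S : s0 \in S by move: S0s0; rewrite S0S /= mem_part => /andP[].
have min_s0 s : s \in S -> (#|` coset_part K S s0| <= #|` coset_part K S s|)%N.
  move=> sS; rewrite -!setcard_fset -S0S; apply: minS0.
  split; first by exists s; rewrite /= mem_part sS subrr sgK.1.
  exists s; apply/esym/(cosetE _ s s) => //; split=> //.
  by exists s => //; exists 0; rewrite ?addr0 //= rpred0.
(* With a single component, [S - S] would lie in [H], so [H] would be the whole group and [H + S]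
   would cover it. *)
have nS : exists2 s, s \in S & s \notin coset_part K S s0.
  apply: contrapT => nex; have SK s : s \in S -> s - s0 \in H.
    move=> sS; rewrite HK; apply: contrapT => /negP sN; apply: nex.
    by exists s; rewrite // mem_part sS.
  have [y yN] := mK; have : generated (diffset [set` S] [set` S]) (y - s0).
    by rewrite genS.
  move=> /(_ H) yH; move: yN; rewrite -[y](subrK s0) mem_fadd // -HK.
  apply: yH => _ [a /= aS [b bS <-]].
  have -> : a - b = (a - s0) - (b - s0) by rewrite opprB addrA subrK.
  by apply: rpredB; apply: SK.
have cK : (#|` fadd K S| + 1 <= #|` S| + #|` K|)%N.
  have [|nex] := pselect (exists y, y \notin S).
    move=> mS; have := kap [fset 0]%fset; rewrite fadd0l cardfs1 addnC; apply=> //.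
    by apply/fset0Pn; exists 0; rewrite inE.
  exfalso; have [y yN] := mK; apply: nex; exists y; apply: contra yN.
  by apply: (fsubsetP (fadd_sub0l _ _)); case: sgK.
have [K1|K2] := leqP #|` K| 1.
  have KE : K = [fset 0]%fset.
    apply/esym/eqP; rewrite eqEfcard cardfs1 K1 andbT fsub1set.
    by case: sgK.
  have HX X : X != fset0 -> (exists y, y \notin fadd X S) ->
      (#|` X| + #|` S| <= #|` fadd X S| + 1)%N.
    by have := kap X; rewrite KE fadd0l cardfs1.
  have HN K' : subgroup K' -> (2 <= #|` K'|)%N -> (exists y, y \notin fadd K' S) ->
      (#|` K'| + #|` S| <= #|` fadd K' S|)%N.
    move=> sgK' K'2 mK'; rewrite leqNgt; apply/negP => ltK'.
    have := maxK K' sgK'; rewrite KE fadd0l cardfs1 fsub1set sgK'.1 => E.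
    by move: K'2; rewrite E ?cardfs1 //; lia.
  have [F [FT cF cF2 k0]] := trivial_hyper_atom HX HN Sn0 nAP mP cS; subst k.
  have S0E0 : coset_part K S s0 = [fset s0]%fset.
    by apply/fsetP => y; rewrite mem_part KE !inE subr_eq0;
      case: eqP => [->|]; rewrite ?s0S ?andbF.
  split.
  (* Here the group has exactly [|2S| + 1] elements, which refutes the assumption of (a). *)
  - case; have -> : [set: G] = [set` F]
      by apply/seteqP; split=> y //= _; apply: FT.
    by apply/card_eq_fsetP; rewrite cF fksumS fksum1.
  - rewrite S0S S0E0 ksum_fset !setcard_fset; split.
      rewrite HKE KE; apply/seteqP; split=> [y [a aS [b]]|y yS] /=.
        by rewrite inE => /eqP-> <-; rewrite addr0.
      by exists y => //; exists 0; rewrite /= ?inE ?addr0.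
    rewrite cardfs1; have -> : fksum 2 [fset s0]%fset = [fset (s0 + s0)%R]%fset.
      rewrite fksumS fksum1 fadd1; apply/fsetP => y.
      by rewrite mem_shift !inE subr_eq.
    by rewrite cardfs1.
  right; split=> //; left; have [x xN] := mP.
  rewrite fksumS fksum1 in xN; exists x.
  have SC := card_sub_complement FT xN cF2.
  apply/seteqP; split=> [y /= yS|_ [a /= /negP aS <-]].
    exists (x - y); last by rewrite subKr.
    by apply/negP; rewrite -SC.
  by rewrite SC subKr.
have [per cS0 c2] := critical_decomposition sgK K2 cK kap s0S min_s0 nS apS cS.
have uniq s z := @unique_sum _ _ _ _ sgK K2 cK s0S min_s0 _ apS s z.
split.
- by rewrite HKE setcard_fset.
- rewrite S0S; split.
    have -> : [set` S] `\` [set` coset_part K S s0] =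
        [set` (S `\` coset_part K S s0)%fset].
      apply/seteqP; split=> y /=; rewrite in_fsetD.
        by move=> [yS /negP yN]; apply/andP.
      by move=> /andP[/negP].
    by rewrite HKE sumset_fset faddC per.
  rewrite ksum_fset !setcard_fset.
  have : (0 < #|` coset_part K S s0|)%N.
    by rewrite cardfs_gt0; apply/fset0Pn; exists s0; apply: mem_part_self.
  by move=> /(leq_mul (leqnn k.+2)); lia.
have phiD x y : phi (x + y) = phi x + phi y.
  by rewrite /phi /canonical_morphism; apply: Quotient.pi_add.
have phiK x y : phi x = phi y <-> x - y \in K.
  rewrite -HK Quotient.idealrBE; split=> [E|/eqP //]; exact/eqP.
have phiB x y : phi (x - y) = phi x - phi y.
  by apply/eqP; rewrite eq_sym subr_eq -phiD subrK.
have gK : cancel repr phi by move=> q; apply: reprK.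
have [k0|k0] := posnP k.
  subst k; right; split=> //; right.
  (* The equation reads [2 phi(s0) = phi(y) + phi(z)], which has only the trivial solution by unique
     expression. *)
  have key y z : y \in S -> z \in S -> phi y - phi s0 = phi s0 - phi z ->
      phi y = phi s0.
    move=> yS zS E; apply: contrapT => ny.
    have yN : y \notin coset_part K S s0.
      by rewrite mem_part yS; apply/negP => /phiK.
    have zS1 : z \in fksum 1 S by rewrite fksum1.
    have /negP := uniq y z yS yN zS1; apply; apply/phiK.
    by move/eqP: E; rewrite mulr2n !phiD subr_eq addrAC => /eqP->; rewrite subrK.
  have phi0 : phi 0 = 0 by rewrite -(subrr s0) phiB subrr.
  have phiS0 a : S0 a -> phi a = phi s0.
    by rewrite S0S /= mem_part => /andP[_ /phiK].
  apply/seteqP; split=> [q []|_ ->].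
    move=> [_ [y yS <-] [_ [a /phiS0 -> <-] <-]] [_ [b /phiS0 -> <-]].
    move=> [_ [z zS <-] E] /=.
    by rewrite (key y z) // phi0 subrr.
  rewrite phi0 -(subrr (phi s0)).
  by split; exists (phi s0); try exists s0 => //; exists (phi s0) => //; exists s0.
left; have -> : [set phi x | x in [set` S]] = [set` proj phi S].
  apply/seteqP; split=> q /=; first by move=> [x xS <-]; apply/imfsetP; exists x.
  by move=> /imfsetP[x /= xS ->]; exists x.
apply: arith_prog_fset.
have [T2|T3] := leqP #|` proj phi S| 2.
  apply: small_progression => //; apply/fset0Pn; exists (phi s0).
  by apply/imfsetP; exists s0.
apply: (proj_progression (g := repr) phiD gK phiK) => //;
  [by case: sgK|exact: c2|].
have psi0 : phi s0 \in proj phi S by apply/imfsetP; exists s0.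
(* The missing points are [3 phi(s0) - t] for [t] in [phi(S)] other than [phi(s0)]; there are at
   least two because [|phi(S)| >= 3]. *)
exists (shift (phi (s0 *+ 3)) (fopp (proj phi S `\ phi s0)%fset)); split=> //.
  by rewrite card_shift card_fopp; move: T3; rewrite (cardfsD1 (phi s0)) psi0.
apply/fdisjointP => q; rewrite mem_shift mem_fopp opprB in_fsetD1 => /andP[qN].
move=> /imfsetP[s /= sS qE]; apply/negP => /faddP[qa [qb []]].
move=> /imfsetP[a /= aS ->] /imfsetP[b /= bS ->] {qa qb} qE'.
have sN : s \notin coset_part K S s0.
  by rewrite mem_part sS /=; apply: contra qN => /phiK sE; rewrite qE sE.
case: k k0 apS cS mP c2 cS0 uniq => // k _ _ _ _ _ _ uniq.
(* Padding with copies of [s0] turns a second expression of [3 phi(s0)] into a second one for the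
   full number of summands. *)
have zS : a + (b + s0 *+ k) \in fksum k.+2 S.
  by rewrite !fksumS !mem_fadd // mem_fksum.
have /negP := uniq s _ sS sN zS; apply; apply/phiK.
have -> : s0 *+ k.+3 = s0 *+ 3 + s0 *+ k by rewrite -mulrnDr.
have -> : s + (a + (b + s0 *+ k)) = s + (a + b) + s0 *+ k by rewrite !addrA.
by rewrite (phiD (s0 *+ 3)) (phiD (s + _)) (phiD s) (phiD a) -qE -qE' subrK.
Qed.
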